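(* Let $\varphi(x)=\max\{0,2-\frac1x\}$ for $x\in(0,1]$ and $\varphi(0)=0$. Let $\mathcal T_n$ be the complete binary tree on $n$ vertices and $p[\mathcal T_n]$ its associated polynomial. Then $p[\mathcal T_n](x)\to\varphi(x)$ uniformly over $x\in[0,1]$ as $n\to\infty$. Consequently, the limiting distribution of $|\mathcal T_{n,\mathfrak S}|$ as $n\to\infty$ coincides with that of $|\mathrm{CBT}_{n,\mathfrak S}|$ as $n\to\infty$, where $\mathrm{CBT}_n$ is the full complete binary tree on $2^n-1$ vertices, and is given by $$\lim_{n\to\infty}\mathbf P\big[|\mathcal T_{n,\mathfrak S}|=m\big]=\lim_{n\to\infty}\mathbf P\big[|\mathrm{CBT}_{n,\mathfrak S}|=m\big]=\binom{2m}{m}\int_0^1x^{m-1}(1-x)^m\varphi(x)\,dx,\qquad m\ge0.$$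
   Context: Trees. $\mathcal T_n$ is the rooted binary tree on $n$ vertices with $2^k$ vertices at height (distance from the root) $k$ for $0\le k<m:=\lfloor\log_2 n\rfloor$, and with the remaining $n-2^m+1$ vertices at height $m$ in their left-most positions. $\mathrm{CBT}_n$ is the rooted binary tree with exactly $2^h$ vertices at every height $h=0,\dots,n-1$ (so $2^n-1$ vertices). A leaf is a vertex without children. Polynomials. To each node $w$ of a finite rooted tree $\mathcal T$ assign $p[w]\in\mathbb Z[x]$ recursively: $p[w](x)=x$ if $w$ is a leaf; otherwise, if $w_1,\dots,w_r$ are the children of $w$, $p[w](x)=x\big(1-\prod_{i=1}^r(1-p[w_i](x))\big)$. Put $p[\mathcal T]:=p[\text{root}]$. Cutting procedure. For a finite rooted tree $\mathcal T$, the root is the unique source and the leaves are the targets. Put $\mathcal T^0=\mathcal T$. As long as $\mathcal T^{i-1}$ is nonempty, choose a vertex of it uniformly at random (independently of the past), delete it with its incident edges, and discard all connected components not containing the root; the result is $\mathcal T^i$ (the empty graph if the root is deleted). $\mathcal T_{\mathfrak S}$ denotes the random graph $\mathcal T^{i}$ at the first $i$ for which $\mathcal T^i$ contains no leaf of the original tree $\mathcal T$, and $|\cdot|$ is the number of vertices. $\mathcal T_{n,\mathfrak S}$ and $\mathrm{CBT}_{n,\mathfrak S}$ denote this graph for $\mathcal T=\mathcal T_n$ and $\mathcal T=\mathrm{CBT}_n$. *)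

(* Defs.v *)
From HB Require Import structures.
From mathcomp Require Import all_boot all_order all_algebra.
From mathcomp Require Import all_classical all_reals all_analysis.
From mathcomp Require Import zify.
Import Order.TTheory GRing.Theory Num.Theory.
Import numFieldNormedType.Exports.

Set Implicit Arguments.
Unset Strict Implicit.
Unset Printing Implicit Defensive.

Local Open Scope ring_scope.

Record rooted_tree := RootedTree {
  vertex :> finType;
  root : vertex;
  parent : vertex -> vertex;  (* the value at the root is a dummy *)
  parent_root : parent root = root;
  reach_root : forall v, exists k, iter k parent v == root
}.

Arguments root {_}.
Arguments parent {_} _.

Section Tree.
Variable T : rooted_tree.
Implicit Types (u v w : T) (A : {set T}).

Definition children w : {set T} := [set v | (v != root) && (parent v == w)].

Definition leaf w : bool := children w == finset.set0.

Definition height v : nat := ex_minn (reach_root v).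

(* Recursion on the tree with fuel [k]; [node_polyE] below shows that #|T|
   is enough fuel. *)
Fixpoint node_poly_rec (k : nat) w : {poly int} :=
  if k is k'.+1 then
    if leaf w then 'X
    else 'X * (1 - \prod_(v in children w) (1 - node_poly_rec k' v))
  else 0.

Definition node_poly w : {poly int} := node_poly_rec #|T| w.

Definition tree_poly : {poly int} := node_poly root.

Lemma iter_parent_root k : iter k parent (@root T) = root.
Proof. by elim: k => //= k ->; rewrite parent_root. Qed.

Lemma height_child w v : v \in children w -> height v = (height w).+1.
Proof.
rewrite inE => /andP[vr /eqP pv]; rewrite /height.
case: ex_minnP => m /eqP vm minm; case: ex_minnP => n /eqP wn minn.
have vn1 : iter n.+1 parent v == root by rewrite iterSr pv wn.
case: m vm minm => [vE|m vm minm]; first by rewrite -vE eqxx in vr.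
apply/eqP; rewrite eqn_leq minm //= ltnS minn //.
by rewrite -pv -iterSr vm.
Qed.

Lemma height_lt_card v : (height v < #|T|)%N.
Proof.
rewrite /height; case: ex_minnP => m /eqP vm minm.
rewrite -[m.+1]card_ord; apply: (@leq_card _ _ (fun i : 'I_m.+1 => iter i parent v)).
have aux (i j : 'I_m.+1) : iter i parent v = iter j parent v -> (i < j)%N -> False.
  move=> e ij; have jm : (j <= m)%N by rewrite -ltnS.
  have : iter (m - j + i) parent v == root.
    by rewrite iterD e -iterD subnK // vm.
  by move/minm; lia.
move=> i j e; apply/val_inj; case: (ltngtP i j) => // ij.
- by case: (aux i j e ij).
- by case: (aux j i (esym e) ij).
Qed.

Lemma node_polyE w : node_poly w =
  if leaf w then 'X
  else 'X * (1 - \prod_(v in children w) (1 - node_poly v)).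
Proof.
have fuel k l u : (#|T| - height u <= k)%N -> (#|T| - height u <= l)%N ->
    node_poly_rec k u = node_poly_rec l u.
  elim: k l u => [|k IH] [|l] u //; try by have := height_lt_card u; lia.
  move=> uk ul /=; case: ifP => // _; congr ('X * (1 - _)).
  apply: eq_bigr => v /height_child hv; congr (1 - _).
  by apply: IH; rewrite hv; lia.
rewrite {1}/node_poly; have := height_lt_card w; case E : #|T| => [|k] // _ /=.
case: ifP => // _; congr ('X * (1 - _)); apply: eq_bigr => v vw; congr (1 - _).
rewrite /node_poly; apply: fuel; rewrite ?leq_subr // E.
by rewrite (height_child vw) subSS leq_subr.
Qed.

Definition adjacent u v : bool := (u \in children v) || (v \in children u).

(* Delete [v] from the graph induced on [A], then keep the connected component
   of the root only; the vertices of the resulting graph. *)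
Definition cut A v : {set T} :=
  let B := A :\ v in
  if root \in B then
    [set u | connect [rel a b | [&& a \in B, b \in B & adjacent a b]] root u]
  else finset.set0.

Definition remaining (s : seq T) : {set T} := foldl cut [set: T] s.

Definition has_leaf A : bool := [exists v in A, leaf v].

Definition first_separation (s : seq T) : bool :=
  ~~ has_leaf (remaining s) &&
  [forall i : 'I_(size s), has_leaf (remaining (take i s))].

(* Probability that, starting from the graph induced on [A], the first [size s]
   vertices deleted are those of [s], in this order. *)
Fixpoint draw_prob (R : realType) A (s : seq T) : R :=
  if s is v :: s' then (v \in A)%:R / #|A|%:R * draw_prob R (cut A v) s' else 1.

(* Probability that the graph at the first time it contains no leaf has [m]
   vertices. Sequences of length at most #|T| suffice, as every step deletes at
   least one vertex. *)
Definition separation_size_prob (R : realType) (m : nat) : R :=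
  \sum_(i < #|T|.+1)
    \sum_(s : i.-tuple T | first_separation s && (#|remaining s| == m))
      draw_prob R [set: T] s.

End Tree.

(* The rooted binary tree with [w k] vertices at every height [k < d], in the
   left-most positions among the 2 ^ k possible ones: the vertex in position [j]
   of height [k.+1] is a child of the one in position [j./2] of height [k]. *)
Section LevelTree.
Variables (d : nat) (w : nat -> nat).
Hypotheses (d_gt0 : (0 < d)%N) (w0 : w 0%N = 1%N).
Hypothesis w_half : forall k j, (k.+1 < d)%N -> (j < w k.+1)%N -> (j./2 < w k)%N.

Definition level_vertex : finType := {k : 'I_d & 'I_(w k)}.

Lemma w0_gt0 : (0 < w (Ordinal d_gt0))%N. Proof. by rewrite w0. Qed.

Definition level_root : level_vertex :=
  existT (fun k : 'I_d => 'I_(w k)) (Ordinal d_gt0) (Ordinal w0_gt0).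

Definition level_parent (v : level_vertex) : level_vertex :=
  let: existT (Ordinal k kd) j := v in
  match k return (k < d)%N -> 'I_(w k) -> level_vertex with
  | 0 => fun _ _ => level_root
  | k'.+1 => fun kd j =>
      existT (fun k : 'I_d => 'I_(w k)) (Ordinal (ltnW kd))
             (Ordinal (w_half kd (ltn_ord j)))
  end kd j.

Lemma level_parent_root : level_parent level_root = level_root.
Proof. by []. Qed.

Lemma level_reach_root v : exists k, iter k level_parent v == level_root.
Proof.
case: v => -[k kd] j; exists k; elim: k kd j => [|k IH] kd j.
  apply/eqP; rewrite /level_root /=; move: j.
  rewrite (bool_irrelevance kd d_gt0) => j; congr existT; apply/val_inj => /=.
  by case: j => j /=; rewrite w0; case: j.
by rewrite iterSr /= IH.
Qed.

Definition level_tree : rooted_tree :=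
  RootedTree level_parent_root level_reach_root.

End LevelTree.

Definition complete_width (n k : nat) : nat :=
  let m := trunc_log 2 n in
  if (k < m)%N then (2 ^ k)%N else (n.+1 - 2 ^ m)%N.

Lemma complete_width0 n : (0 < n)%N -> complete_width n 0 = 1%N.
Proof.
move=> n0; rewrite /complete_width; case: ifP => // /negbT; rewrite -eqn0Ngt => /eqP e.
have := trunc_log_ltn n (isT : 1 < 2)%N.
by rewrite e; case: n n0 {e} => [|[|]].
Qed.

Lemma complete_width_half n k j : (k.+1 < (trunc_log 2 n).+1)%N ->
  (j < complete_width n k.+1)%N -> (j./2 < complete_width n k)%N.
Proof.
rewrite ltnS /complete_width => km; rewrite km => jw.
rewrite ltn_half_double -mul2n -expnS; move: jw; case: ifP => // /negbT.
rewrite -leqNgt => mk; have -> : trunc_log 2 n = k.+1 by apply/eqP; rewrite eqn_leq mk.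
move=> /leq_trans; apply; rewrite leq_subLR addnn -mul2n -expnS.
have <- : trunc_log 2 n = k.+1 by apply/eqP; rewrite eqn_leq mk.
exact: trunc_log_ltn.
Qed.

Lemma full_width_half n k j : (k.+1 < n)%N -> (j < 2 ^ k.+1)%N -> (j./2 < 2 ^ k)%N.
Proof. by move=> _; rewrite ltn_half_double -mul2n -expnS. Qed.

(* The tree T_n on n vertices; [trunc_log 2 n] is the integer part of log_2 n. *)
Definition complete_tree (n : nat) (n_gt0 : (0 < n)%N) : rooted_tree :=
  level_tree (ltn0Sn (trunc_log 2 n)) (complete_width0 n_gt0)
             (@complete_width_half n).

(* The tree CBT_n on 2 ^ n - 1 vertices. *)
Definition full_tree (n : nat) (n_gt0 : (0 < n)%N) : rooted_tree :=
  level_tree n_gt0 (expn0 2) (@full_width_half n).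

Definition phi (R : realType) (x : R) : R :=
  if x == 0 then 0 else Num.max 0 (2 - x^-1).

(* Main.v *)
Require Import Defs.
From HB Require Import structures.
From mathcomp Require Import all_boot all_order all_algebra.
From mathcomp Require Import all_classical all_reals all_analysis.
From mathcomp Require Import zify ring lra.
Import Order.TTheory GRing.Theory Num.Theory.
Import numFieldNormedType.Exports.
(* Finite sets, rather than classical sets, own the shared lemma names. *)
From mathcomp Require Import fintype finset.

(** The number p[w](x) is the probability that w is joined to a leaf below it
    when every vertex is kept independently with probability x
    ([node_poly_mean]). At a vertex with two children it is obtained from the
    values at the children by p, q |-> x (1 - (1 - p) (1 - q)), and phi(x) is
    the attracting fixed point of the diagonal map. The distance e to phi(x)
    shrinks at each step to at most e - e^2 / 8, so that it is at most
    8 / (k + 8) after k steps, uniformly in x ([percolates_dist]). The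
    irregular bottom of the tree only affects the value from which the
    iteration starts, and that value lies between x^2 and x. This gives the
    uniform convergence.

    For the second part, think of the vertices as carrying independent uniform
    clocks: the graph left at time 1 - x is the component of the root in site
    percolation with parameter x. Call a vertex a pivot if deleting it
    separates the root from the leaves and leaves a component of m vertices.
    Then the probability of ending with m vertices is the integral over [0, 1]
    of Q(x) / x, where Q(x) is the mean number of pivots
    ([separation_size_probE]). No clocks are needed to prove this: conditioning
    on the first deleted vertex of a set A says that |A| times the probability
    for A is the number of pivots of A plus the sum over v in A of the
    probabilities for A minus v, and this is what Russo's formula
    x Q_A'(x) = sum_v (Q_A(x) - Q_{A - v}(x)) gives when it is divided by x and
    integrated ([log_integral_russo]).

    It remains to find Q. Percolations in disjoint subtrees are independent, so
    the generating functions, according to the size of the component, of the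
    leafless configurations and of the pivots satisfy simple recursions
    ([mean_leaflessE], [mean_separatingE]). As long as the tree below a vertex
    branches in two, the component is leafless of size j with probability
    C_j x^j (1 - x)^(j + 1), where C_j is the Catalan number, and Q(x) is the
    sum over the C_m possible components of size m and their m + 1 boundary
    vertices v of x^m (1 - x)^m p[v](x). Since C_m (m + 1) = binomial(2 m, m)
    and p[v] is close to phi, Q(x) / x converges to
    binomial(2 m, m) x^(m - 1) (1 - x)^m phi(x), uniformly in x
    ([separating_coef]), and the integrals converge. *)

Set Implicit Arguments.
Unset Strict Implicit.
Unset Printing Implicit Defensive.
Local Open Scope ring_scope.

(** * Root components and cutting *)

Section Component.
Variable T : rooted_tree.
Implicit Types (u v w : T) (A B : {set T}).

(** Only edges from a parent to a child are followed: a component whose highest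
    vertex is [w] needs no others, and recursion over the tree becomes possible. [cutE] relates this to the undirected connectivity of [cut]. *)
Definition component w B : {set T} :=
  [set u | (w \in B) && connect [rel a b | (b \in B) && (b \in children a)] w u].

Lemma tree_ind (P : T -> Prop) :
  (forall w, (forall u, u \in children w -> P u) -> P w) -> forall w, P w.
Proof.
move=> step w; have [k] := ubnP (#|T| - height w)%N.
elim: k w => // k IH w wk; apply: step => u /height_child hu; apply: IH.
by have := height_lt_card w; lia.
Qed.

Lemma componentE w B : component w B =
  if w \in B then w |: \bigcup_(u in children w) component u B else finset.set0.
Proof.
case: ifP => wB; last by apply/setP => u; rewrite !inE wB.
apply/setP => v; rewrite !inE wB /=.
apply/connectP/orP => [[[|u p] /= pth ->]|[/eqP->|/bigcupP[u uw]]].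
- by left.
- move: pth => /andP[/andP[uB uw] pth]; right; apply/bigcupP; exists u => //.
  by rewrite inE uB; apply/connectP; exists p.
- by exists [::].
- rewrite inE => /andP[uB /connectP[p pth ->]]; exists (u :: p) => //=.
  by rewrite uB uw.
Qed.

Lemma component_in w B : (w \in component w B) = (w \in B).
Proof. by rewrite componentE; case: ifP => wB; rewrite ?inE ?eqxx. Qed.

Lemma component_out w B : w \notin B -> component w B = finset.set0.
Proof. by rewrite componentE => /negbTE->. Qed.

Lemma component_sub w B : component w B \subset B.
Proof.
elim/tree_ind: w => w IH; rewrite componentE; case: ifP => wB; last by rewrite sub0set.
by rewrite subUset sub1set wB; apply/bigcupsP.
Qed.

Lemma component_child w u v B :
  u \in component w B -> v \in children u -> v \in B -> v \in component w B.
Proof.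
rewrite !inE => /andP[-> wu] vu vB /=; apply: connect_trans wu _.
by apply: connect1; rewrite /= vB inE.
Qed.

Lemma componentS w A B : A \subset B -> component w A \subset component w B.
Proof.
move=> AB; elim/tree_ind: w => w IH; rewrite [component w A]componentE [component w B]componentE.
case: ifP => wA; last by rewrite sub0set.
rewrite (subsetP AB _ wA); apply: setUS; apply/bigcupsP => u uw.
by apply: (subset_trans (IH u uw)); apply: (finset.bigcup_sup u).
Qed.

(** Deleting vertices that are already disconnected changes nothing; this lets a
    state of the cutting procedure be replaced by an arbitrary subset of the
    vertices with the same root component. *)
Lemma component_restrict w A B : component w (B :&: component w A) = component w (B :&: A).
Proof.
apply/eqP; rewrite eqEsubset; apply/andP; split.
  by apply/componentS/setIS/component_sub.
apply/fintype.subsetP => v; rewrite inE => /andP[wBA /connectP[p pth ->]].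
have wC : w \in component w (B :&: component w A).
  move: wBA; rewrite component_in inE => /andP[wB wA].
  by rewrite inE wB component_in.
elim/last_ind: p pth => //= p u IH; rewrite rcons_path last_rcons => /andP[/IH pC].
rewrite /= => /andP[]; rewrite in_setI => /andP[uB uA] uc.
apply: (component_child pC uc); rewrite in_setI uB; apply: component_child uc uA.
by have /(subsetP (component_sub _ _)) := pC; rewrite in_setI => /andP[].
Qed.

Definition below w : {set T} := component w [set: T].

Lemma component_below w B : component w (B :&: below w) = component w B.
Proof. by rewrite component_restrict setIT. Qed.

(** A descendant determines its ancestor at each height, which is why the
    subtrees of siblings are disjoint. *)
Lemma height_below w v : v \in below w ->
  (height w <= height v)%N /\ iter (height v - height w) parent v = w.
Proof.
rewrite inE => /andP[_ /connectP[p pth ->]] {v}.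
elim/last_ind: p pth => [|p u IH] /=; first by rewrite subnn.
rewrite rcons_path last_rcons /= => /andP[/IH{IH}[hw pw] /andP[_ uc]].
rewrite (height_child uc); split; first lia.
by rewrite subSn // iterSr; move: uc; rewrite inE => /andP[_ /eqP->].
Qed.

Lemma below_notin w u : u \in children w -> w \notin below u.
Proof. by move=> uw; apply/negP => /height_below[]; rewrite (height_child uw) ltnn. Qed.

Lemma below_disjoint w u v : u \in children w -> v \in children w -> u != v ->
  [disjoint below u & below v].
Proof.
move=> uw vw uv; rewrite -setI_eq0; apply/set0Pn => -[a]; rewrite inE.
case/andP => /height_below[_ ua] /height_below[_ va]; case/eqP: uv.
by rewrite -ua -[in RHS]va (height_child uw) (height_child vw).
Qed.

Lemma below_root : below Defs.root = [set: T].
Proof.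
apply/setP => v; rewrite [RHS]inE; have [k] := ubnP (height v).
elim: k v => // k IH v vk; have [->|vr] := eqVneq v Defs.root; first by rewrite component_in inE.
have vp : v \in children (parent v) by rewrite inE vr eqxx.
by apply: (component_child _ vp (in_setT _)); apply: IH; rewrite -(height_child vp).
Qed.

(** A path from the root that climbs at some point can be shortened, because a
    climb leads back to a vertex that was passed on the way down. *)
Lemma cutE A v : Defs.cut A v = component Defs.root (A :\ v).
Proof.
rewrite /Defs.cut; set B := A :\ v; case: ifP => rB; last by rewrite component_out ?rB.
apply/setP => u; rewrite inE; apply/idP/idP => [/connectP[p pth ->]|].
  elim/last_ind: p pth => [|p b IH] /=; first by rewrite component_in.
  rewrite rcons_path last_rcons => /andP[/IH] {IH}; set a := last _ _ => aC /and3P[aB bB].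
  case/orP => [ba|ab]; last exact: component_child aC ab bB.
  (* Here [b] is the parent of [a], hence the last but one vertex on the path from
     the root down to [a]. *)
  move: aC; rewrite {1}inE rB => /connectP[q + aE].
  elim/last_ind: q aE => [|q c _] /=; first by move=> aE; move: ba; rewrite inE aE eqxx.
  rewrite rcons_path last_rcons => ac /andP[pq /= /andP[_ cq]].
  suff -> : b = last Defs.root q by rewrite inE rB; apply/connectP; exists q.
  by move: ba cq; rewrite -ac !inE => /andP[_ /eqP<-] /andP[_ /eqP].
rewrite inE rB => /connectP[p pth ->].
elim/last_ind: p pth => [|p b IH] //=.
rewrite rcons_path last_rcons => /andP[pth bc]; apply: connect_trans (IH pth) _.
have : last Defs.root p \in component Defs.root B by rewrite inE rB; apply/connectP; exists p.
move=> /(subsetP (component_sub _ _)) aB; apply: connect1 => /=.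
by case/andP: bc => bB bc; rewrite aB bB /Defs.adjacent bc orbT.
Qed.
End Component.

(** * Site percolation on a finite set *)

Section Percolation.
Variables (T : finType) (S : comNzRingType) (x : S).
Implicit Types (A B : {set T}) (f g : {set T} -> S).

Definition weight B : S := \prod_v (if v \in B then x else 1 - x).

(** Every vertex belongs to the random set independently with probability [x].
    The parameter lives in an arbitrary commutative ring, so that it can be a real
    number, the indeterminate, or a constant in a ring of generating functions. *)
Definition mean f : S := \sum_B weight B * f B.

Definition depends_on A f := forall B, f (B :&: A) = f B.

Lemma mean_ext f g : f =1 g -> mean f = mean g.
Proof. by move=> fg; apply: eq_bigr => B _; rewrite fg. Qed.

Lemma mean_cst c : mean (fun=> c) = c.
Proof.
rewrite /mean -mulr_suml -[RHS]mul1r; congr (_ * _).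
rewrite /weight -bigA_distr big1 // => v _ /=; ring.
Qed.

Lemma meanD f g : mean (fun B => f B + g B) = mean f + mean g.
Proof. by rewrite /mean -big_split; apply: eq_bigr => B _; rewrite mulrDr. Qed.

Lemma meanZ c f : mean (fun B => c * f B) = c * mean f.
Proof. by rewrite /mean mulr_sumr; apply: eq_bigr => B _; rewrite mulrCA. Qed.

Lemma meanB f g : mean (fun B => f B - g B) = mean f - mean g.
Proof.
rewrite /mean -sumrB; apply: eq_bigr => B _; by rewrite mulrBr.
Qed.

(** The product formula for sums over subsets, with the weight of absence put to
    zero at [v]. *)
Lemma mean_in v : mean (fun B => (v \in B)%:R) = x.
Proof.
pose F (u : T) : S := x; pose G (u : T) : S := if u == v then 0 else 1 - x.
transitivity (\sum_(B : {set T}) \prod_u (if u \in B then F u else G u)).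
  apply: eq_bigr => B _; have [vB|vB] := boolP (v \in B).
    rewrite mulr1; apply: eq_bigr => u _; rewrite /G.
    by case: ifP => // uB; case: eqP => // uv; move: uB; rewrite uv vB.
  by rewrite mulr0 (bigD1 v) //= (negbTE vB) /G eqxx mul0r.
rewrite -bigA_distr (bigD1 v) //= /F /G eqxx addr0.
rewrite big1 ?mulr1 // => u /negbTE-> /=; ring.
Qed.

(** Exchanging the traces outside [A] of two independent copies of the random set is an
    involution that preserves the product weight. *)
Lemma mean_indep A A' f g : [disjoint A & A'] ->
  depends_on A f -> depends_on A' g ->
  mean (fun B => f B * g B) = mean f * mean g.
Proof.
move=> AA' fA gA'.
pose swap (p : {set T} * {set T}) :=
  ((p.1 :&: A) :|: (p.2 :\: A), (p.2 :&: A) :|: (p.1 :\: A)).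
have swapK : involutive swap.
  by case=> B C; congr pair; apply/setP => v; rewrite !inE /=; case: (v \in A); rewrite ?andbT ?andbF ?orbF.
rewrite [in RHS]/mean big_distrlr /= pair_bigA /=.
rewrite (reindex_inj (inv_inj swapK)) /=.
transitivity (\sum_(p : {set T} * {set T})
   (weight p.1 * (f p.1 * g p.1)) * weight p.2); last first.
  apply: eq_bigr => -[B C] _ /=.
  have -> : f ((B :&: A) :|: (C :\: A)) = f B.
    by rewrite -fA -[RHS]fA; congr f; apply/setP => v; rewrite !inE; case: (v \in A); rewrite ?andbT ?andbF ?orbF.
  have -> : g ((C :&: A) :|: (B :\: A)) = g B.
    rewrite -gA' -[RHS]gA'; congr g; apply/setP => v; rewrite !inE.
    have [vA|] := boolP (v \in A); last by rewrite ?andbT ?andbF ?orbF.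
    by rewrite (disjointFr AA' vA) !andbF.
  have : weight ((B :&: A) :|: (C :\: A)) * weight ((C :&: A) :|: (B :\: A))
     = weight B * weight C.
    rewrite /weight -!big_split; apply: eq_bigr => v _ /=; rewrite !inE.
    by case: (v \in A); rewrite ?andbT ?andbF ?orbF //= mulrC.
  by move=> e; rewrite mulrACA e; ring.
rewrite -(pair_bigA _ (fun B C => weight B * (f B * g B) * weight C)) /=.
apply: eq_bigr => B _; rewrite -mulr_sumr -[LHS]mulr1; congr (_ * _).
by rewrite -[LHS](mean_cst 1); apply: eq_bigr => C _; rewrite mulr1.
Qed.

Lemma mean_indep_prod (I : finType) (r : seq I) (A : I -> {set T}) (f : I -> {set T} -> S) :
  uniq r ->
  {in r &, forall i j, i != j -> [disjoint A i & A j]} ->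
  {in r, forall i, depends_on (A i) (f i)} ->
  mean (fun B => \prod_(i <- r) f i B) = \prod_(i <- r) mean (f i).
Proof.
elim: r => [|i r IH] /=.
  by rewrite big_nil => _ _ _; rewrite -[RHS](mean_cst 1); apply: mean_ext => B; rewrite big_nil.
move=> /andP[ir ur] dis dep; rewrite big_cons -IH //; last 2 first.
- by move=> j k jr kr; apply: dis; rewrite inE ?jr ?kr orbT.
- by move=> j jr; apply: dep; rewrite inE jr orbT.
rewrite -(@mean_indep (A i) (\bigcup_(j <- r) A j)).
- by apply: mean_ext => B; rewrite big_cons.
- rewrite disjoint_sym; apply/pred0P => v /=; apply/negbTE; apply/negP => /andP[].
  rewrite big_seq; elim/big_rec: _ => [|j C jr IHC]; first by rewrite inE.
  rewrite inE => /orP[vj vi|//].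
  have ij : i != j by apply: contraNneq ir => ->.
  by have := dis i j; rewrite !inE eqxx jr orbT => /(_ isT isT ij)/disjointFr/(_ vi); rewrite vj.
- by apply: dep; rewrite inE eqxx.
- move=> B; rewrite big_seq [RHS]big_seq; apply: eq_bigr => j jr.
  have dj : depends_on (A j) (f j) by apply: dep; rewrite inE jr orbT.
  rewrite -dj -[RHS]dj -setIA; congr (f j (_ :&: _)).
  by apply/setIidPr; rewrite bigcup_seq; apply: (finset.bigcup_sup j).
Qed.

Lemma mean_cond v A f g : v \notin A -> depends_on A f -> depends_on A g ->
  mean (fun B => if v \in B then f B else g B) = x * mean f + (1 - x) * mean g.
Proof.
move=> vA fA gA; have dis : [disjoint [set v] & A] by rewrite disjoints1.
have dv : depends_on [set v] (fun B => (v \in B)%:R).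
  by move=> B; rewrite !inE eqxx andbT.
have dv' : depends_on [set v] (fun B => 1 - (v \in B)%:R).
  by move=> B; rewrite !inE eqxx andbT.
have -> : 1 - x = mean (fun B => 1 - (v \in B)%:R) by rewrite meanB mean_cst mean_in.
rewrite -{1}(mean_in v).
rewrite -(mean_indep dis dv fA) -(mean_indep dis dv' gA) -meanD.
by apply: mean_ext => B; case: (v \in B) => /=; ring.
Qed.
End Percolation.

(** * Percolation on a rooted tree *)

Section GeneratingFunctions.
Variable T : rooted_tree.
Implicit Types (u v w : T) (A B : {set T}).

Lemma has_leafP A : reflect (exists2 v, v \in A & leaf v) (has_leaf A).
Proof. by apply: (iffP existsP) => [[v /andP[]]|[v vA vl]]; exists v => //; rewrite vA. Qed.

Lemma has_leafS A B : A \subset B -> has_leaf A -> has_leaf B.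
Proof. by move=> AB /has_leafP[v vA vl]; apply/has_leafP; exists v => //; apply: (subsetP AB). Qed.

Lemma has_leaf0 : has_leaf (finset.set0 : {set T}) = false.
Proof. by apply/negbTE/has_leafP => -[v]; rewrite inE. Qed.

Lemma has_leaf_component w B : has_leaf (component w B) =
  (w \in B) && (leaf w || [exists u in children w, has_leaf (component u B)]).
Proof.
rewrite componentE; case: ifP => wB /=; last exact: has_leaf0.
apply/has_leafP/orP => [[v]|[wl|/existsP[u /andP[uw /has_leafP[v vu vl]]]]].
- rewrite !inE => /orP[/eqP->|/bigcupP[u uw vu] vl]; first by left.
  by right; apply/existsP; exists u; rewrite uw; apply/has_leafP; exists v.
- by exists w => //; rewrite !inE eqxx.
- by exists v => //; rewrite inE; apply/orP; right; apply/bigcupP; exists u.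
Qed.

(** The components of the children lie in disjoint subtrees. *)
Lemma card_component w B : w \in B ->
  #|component w B| = (\sum_(u in children w) #|component u B|).+1.
Proof.
move=> wB; rewrite componentE wB cardsU1; have -> : w \notin \bigcup_(u in children w) component u B.
  apply/bigcupP => -[u uw]; move/(subsetP (componentS u (subsetT B))).
  by apply/negP; apply: below_notin.
congr S; rewrite (@big_mkcond _ (finset.set0 : {set T})) -sum1_card partition_disjoint_bigcup.
  rewrite [RHS]big_mkcond; apply: eq_bigr => u _; case: ifP => _; rewrite sum1_card ?cards0 //.
move=> u v uv; case: ifP => uw; last by rewrite -setI_eq0 finset.set0I.
case: ifP => vw; last by rewrite -setI_eq0 finset.setI0.
have := below_disjoint uw vw uv.
by apply: disjointW; apply/componentS/subsetT.
Qed.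

Variables (S : comNzRingType) (x z : S).

(** Its mean is the series whose coefficient of degree j is the probability that the
    component of [w] has size j and avoids the leaves. *)
Definition leafless z w B : S := (~~ has_leaf (component w B))%:R * z ^+ #|component w B|.

Lemma leaflessE w B : leafless z w B =
  if w \in B then if leaf w then 0 else z * \prod_(u in children w) leafless z u B
  else 1.
Proof.
rewrite /leafless has_leaf_component; case: ifP => wB; last first.
  by rewrite component_out ?wB // cards0 mulr1.
have [wl|wl] /= := boolP (leaf w); first by rewrite mul0r.
rewrite big_split /= prodrXr card_component // exprS mulrCA; congr (_ * (_ * _)).
rewrite -natr_prod; congr (_%:R).
have [/existsP[u /andP[uw ul]]|] /= := boolP [exists u in children w, has_leaf (component u B)].
  by rewrite (bigD1 u) //= ul.
by rewrite negb_exists => /forallP nl; rewrite big1 // => u uw; have := nl u; rewrite uw /= => ->.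
Qed.

Lemma leafless_depends w : depends_on (below w) (leafless z w).
Proof. by move=> B; rewrite /leafless component_below. Qed.

Definition mean_leafless w : S := mean x (leafless z w).

Lemma prod_leafless_depends w :
  depends_on (~: [set w]) (fun B => \prod_(u in children w) leafless z u B).
Proof.
move=> B; apply: eq_bigr => u uw; rewrite -leafless_depends -[RHS]leafless_depends.
congr leafless; rewrite -setIA; congr (_ :&: _); apply/setIidPr.
by rewrite finset.subsetC sub1set in_setC below_notin.
Qed.

(** Either [w] is deleted, with an empty component, or [w] is kept and the
    components of its children are independent. *)
Lemma mean_leaflessE w : mean_leafless w =
  1 - x + (if leaf w then 0 else x * z * \prod_(u in children w) mean_leafless u).
Proof.
rewrite /mean_leafless (mean_ext x (leaflessE w)).
have wC : w \notin ~: [set w] by rewrite !inE eqxx.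
rewrite (@mean_cond _ _ x w (~: [set w])) //; last first.
  by move=> B; case: ifP => // _; rewrite prod_leafless_depends.
rewrite mean_cst mulr1 addrC; congr (_ + _).
case: ifP => _; first by rewrite mean_cst mulr0.
rewrite meanZ -mulrA; congr (_ * (_ * _)).
transitivity (mean x (fun B => \prod_(u <- enum (children w)) leafless z u B)).
  by apply: mean_ext => B; rewrite big_enum.
rewrite (@mean_indep_prod _ _ x _ _ (@below T)) ?enum_uniq ?big_enum //.
  by move=> u v; rewrite !mem_enum => uw vw; exact: (below_disjoint uw vw).
by move=> u _; apply: leafless_depends.
Qed.

End GeneratingFunctions.

(** At [z = 1] the generating function of leafless components becomes the
    probability of being cut off from the leaves, and [mean_leaflessE] the
    recursion that defines the polynomials. *)
Lemma node_poly_mean (T : rooted_tree) (R : comNzRingType) (x : R) (w : T) :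
  (map_poly intr (node_poly w)).[x] = 1 - mean_leafless x 1 w.
Proof.
elim/tree_ind: w => w IH; rewrite node_polyE mean_leaflessE.
case: ifP => _; first by rewrite map_polyX hornerX addr0 opprB addrCA subrr addr0.
rewrite rmorphM rmorphB rmorph1 rmorph_prod /= map_polyX hornerM hornerX hornerD hornerN.
rewrite horner_prod -[1]/(1%:P) hornerC mulr1.
suff -> : \prod_(u in children w) (map_poly intr (1 - node_poly u)).[x] =
  \prod_(u in children w) mean_leafless x 1 u by ring.
apply: eq_bigr => u uw.
by rewrite rmorphB rmorph1 /= hornerD hornerN -[1]/(1%:P) hornerC IH //; ring.
Qed.

Section Cuts.
Variables (T : rooted_tree) (S : comNzRingType) (x z : S).
Implicit Types (u v w : T) (A B : {set T}).

(** The first factor is the indicator of a component that meets the leaves, so that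
    the vertices that count in the sum are the pivots, each with the size that its
    deletion leaves. *)
Definition separating z w B : S :=
  (1 - leafless 1 w B) * \sum_v leafless z w (B :\ v).

Definition mean_separating w : S := mean x (separating z w).

Lemma leafless_setD1 w v B : v \notin below w -> leafless z w (B :\ v) = leafless z w B.
Proof.
move=> vw; rewrite -leafless_depends -[RHS]leafless_depends; congr leafless.
by apply/setP => u; rewrite !in_setI in_setD1; case: eqP => //= ->; rewrite (negbTE vw) andbF.
Qed.

Lemma leafless_sep w B : (1 - leafless 1 w B) * leafless z w B = 0.
Proof.
rewrite /leafless expr1n mulr1; case: (has_leaf _) => /=; first by rewrite mul0r mulr0.
by rewrite subrr mul0r.
Qed.

(** Deleting [w] itself leaves an empty component. To be a pivot below [u1], a
    vertex must cut [u1] off from the leaves while [u2] is cut off already, and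
    conversely; a vertex outside both subtrees has no effect. *)
Lemma separatingE w u1 u2 B : u1 != u2 -> children w = [set u1; u2] ->
  separating z w B = if w \in B then
    1 - leafless 1 u1 B * leafless 1 u2 B +
    z * (separating z u1 B * leafless z u2 B + leafless z u1 B * separating z u2 B)
  else 0.
Proof.
move=> u12 cw; rewrite /separating; case: ifP => wB; last first.
  by rewrite [leafless 1 w B]leaflessE wB subrr mul0r.
have wl : leaf w = false.
  by apply/negbTE/set0Pn; exists u1; rewrite cw !inE eqxx.
have u1w : u1 \in children w by rewrite cw !inE eqxx.
have u2w : u2 \in children w by rewrite cw !inE eqxx orbT.
have prodw (F : T -> S) : \prod_(u in children w) F u = F u1 * F u2.
  by rewrite cw big_setU1 ?big_set1 // inE.
set L1 := 1 - leafless 1 u1 B; set L2 := 1 - leafless 1 u2 B.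
rewrite [leafless 1 w B]leaflessE wB wl prodw mul1r.
rewrite (bigD1 w) //= [leafless z w (B :\ w)]leaflessE in_setD1 eqxx /= mulrDr mulr1; congr (_ + _).
have -> : z * (L1 * (\sum_v leafless z u1 (B :\ v)) * leafless z u2 B +
    leafless z u1 B * (L2 * \sum_v leafless z u2 (B :\ v))) =
  \sum_v z * (L1 * leafless z u1 (B :\ v) * leafless z u2 B +
    leafless z u1 B * (L2 * leafless z u2 (B :\ v))).
  by rewrite -mulr_sumr big_split /= -mulr_suml -!mulr_sumr.
have L1N : L1 * leafless z u1 B = 0 := leafless_sep _ _.
have L2N : L2 * leafless z u2 B = 0 := leafless_sep _ _.
rewrite mulr_sumr [RHS](bigD1 w) //= !leafless_setD1 ?below_notin //.
rewrite L1N L2N mulr0 mul0r addr0 mulr0 add0r.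
apply: eq_bigr => v vw.
rewrite [leafless z w (B :\ v)]leaflessE in_setD1 eq_sym vw wB wl prodw /=.
have -> : 1 - leafless 1 u1 B * leafless 1 u2 B = L1 + L2 - L1 * L2.
  by rewrite /L1 /L2; ring.
move: L1N L2N; move: L1 L2 => L1 L2 L1N L2N.
have [v1|v1] := boolP (v \in below u1).
  rewrite [leafless z u2 (B :\ v)]leafless_setD1; last first.
    by rewrite (disjointFr (below_disjoint u1w u2w u12) v1).
  set p := leafless z u1 (B :\ v).
  transitivity (z * (L1 * p * leafless z u2 B)
    + z * p * (1 - L1) * (L2 * leafless z u2 B)); first by ring.
  by rewrite L2N; ring.
rewrite [leafless z u1 (B :\ v)]leafless_setD1 //.
have [v2|v2] := boolP (v \in below u2); last first.
  rewrite leafless_setD1 // L1N L2N !mulr0 mul0r addr0 mulr0.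
  transitivity (z * leafless z u2 B * (1 - L2) * (L1 * leafless z u1 B)
    + z * leafless z u1 B * (L2 * leafless z u2 B)); first by ring.
  by rewrite L1N L2N !mulr0 addr0.
set p := leafless z u2 (B :\ v).
transitivity (z * (L2 * p * leafless z u1 B)
  + z * p * (1 - L2) * (L1 * leafless z u1 B)); first by ring.
by rewrite L1N; ring.
Qed.

Lemma separating_depends w : depends_on (below w) (separating z w).
Proof.
move=> B; rewrite /separating leafless_depends; congr (_ * _).
apply: eq_bigr => v _; rewrite -[RHS]leafless_depends -leafless_depends; congr leafless.
by rewrite -finset.setIDAC -finset.setIA finset.setIid.
Qed.

Lemma mean_separatingE w u1 u2 : u1 != u2 -> children w = [set u1; u2] ->
  mean_separating w = x * (1 - mean_leafless x 1 u1 * mean_leafless x 1 u2) +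
    x * z * (mean_separating u1 * mean_leafless x z u2 +
             mean_leafless x z u1 * mean_separating u2).
Proof.
move=> u12 cw.
have u1w : u1 \in children w by rewrite cw !inE eqxx.
have u2w : u2 \in children w by rewrite cw !inE eqxx orbT.
have dis := below_disjoint u1w u2w u12.
rewrite /mean_separating (mean_ext x (fun B => separatingE B u12 cw)).
rewrite (@mean_cond _ _ x w (below u1 :|: below u2)) //; first last.
- move=> B; have r1 : B :&: (below u1 :|: below u2) :&: below u1 = B :&: below u1.
    by rewrite -finset.setIA; congr (_ :&: _); apply/setIidPr/finset.subsetUl.
  have r2 : B :&: (below u1 :|: below u2) :&: below u2 = B :&: below u2.
    by rewrite -finset.setIA; congr (_ :&: _); apply/setIidPr/finset.subsetUr.
  rewrite -[leafless 1 u1 (_ :&: _)]leafless_depends -[leafless 1 u2 (_ :&: _)]leafless_depends.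
  rewrite -[leafless z u1 (_ :&: _)]leafless_depends -[leafless z u2 (_ :&: _)]leafless_depends.
  rewrite -[separating z u1 (_ :&: _)]separating_depends -[separating z u2 (_ :&: _)]separating_depends.
  by rewrite r1 r2 !leafless_depends !separating_depends.
- by rewrite inE negb_or !below_notin.
rewrite mean_cst mulr0 addr0 meanD meanB mean_cst meanZ meanD.
rewrite (mean_indep x dis (leafless_depends 1 u1) (leafless_depends 1 u2)).
rewrite (mean_indep x dis (separating_depends u1) (leafless_depends z u2)).
rewrite (mean_indep x dis (leafless_depends z u1) (separating_depends u2)).
by rewrite /mean_leafless; ring.
Qed.

End Cuts.

(** * The cutting procedure as an integral over the percolation parameter *)

Section LogIntegral.
Variable R : realType.
Implicit Types p q : {poly R}.

(** The primitive of p(x) / x that vanishes at 0, for p without constant term; since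
    the inverse of 0 is 0, a constant term is simply ignored. *)
Definition log_prim p : {poly R} := \poly_(i < size p) (p`_i / i%:R).

Lemma coef_log_prim p i : (log_prim p)`_i = p`_i / i%:R.
Proof.
rewrite coef_poly; case: ltnP => // pi.
by rewrite (nth_default 0 pi) mul0r.
Qed.

(** The integral of p(x) / x over the interval from 0 to 1, in a form that makes
    linearity and the fundamental theorem of calculus matters of coefficients. *)
Definition log_integral p : R := (log_prim p).[1].

Lemma log_integralD p q : log_integral (p + q) = log_integral p + log_integral q.
Proof.
rewrite /log_integral -hornerD; congr (_.[1]); apply/polyP => i.
by rewrite coefD !coef_log_prim coefD mulrDl.
Qed.

Lemma log_integralN p : log_integral (- p) = - log_integral p.
Proof.
rewrite /log_integral -hornerN; congr (_.[1]); apply/polyP => i.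
by rewrite coefN !coef_log_prim coefN mulNr.
Qed.

Lemma log_integral0 : log_integral 0 = 0.
Proof.
rewrite /log_integral (_ : log_prim 0 = 0) ?horner0 //.
by apply/polyP => i; rewrite coef_log_prim coef0 mul0r.
Qed.

Lemma log_integral_sum (I : finType) (P : pred I) (F : I -> {poly R}) :
  log_integral (\sum_(i | P i) F i) = \sum_(i | P i) log_integral (F i).
Proof.
by apply: (big_morph _ log_integralD log_integral0).
Qed.

Lemma log_integral_deriv p : log_integral ('X * p^`()) = p.[1] - p.[0].
Proof.
have -> : p.[0] = (p`_0)%:P.[1] by rewrite hornerC horner_coef0.
rewrite -hornerN -hornerD /log_integral.
congr (_.[1]); apply/polyP => i; rewrite coef_log_prim coefXM coefB coefC.
case: i => [|i] /=; first by rewrite mul0r subrr.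
by rewrite coef_deriv subr0 -[_ *+ _]mulr_natr mulfK // pnatr_eq0.
Qed.

End LogIntegral.

Section Russo.
Variables (R : realType) (T : finType).
Implicit Types (A B : {set T}) (F : {set T} -> R).

Definition mean_poly F : {poly R} := mean 'X (fun B => (F B)%:P).

Lemma horner_mean_poly F (a : R) : (mean_poly F).[a] = mean a F.
Proof.
rewrite /mean_poly /mean horner_sum; apply: eq_bigr => B _.
rewrite hornerM hornerC horner_prod; congr (_ * _); apply: eq_bigr => v _.
by case: ifP; rewrite ?hornerX // hornerD hornerN hornerX -[1]/(1%:P) hornerC.
Qed.

Lemma mean1 (S : comNzRingType) (f : {set T} -> S) : mean 1 f = f [set: T].
Proof.
rewrite /mean (bigD1 [set: T]) //= [X in _ + X]big1 => [|B].
  by rewrite addr0 /weight big1 ?mul1r // => v _; rewrite inE.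
rewrite -finset.subTset => /subsetPn[v _ vB].
by rewrite /weight (bigD1 v) //= (negbTE vB) subrr !mul0r.
Qed.

Lemma mean0 (S : comNzRingType) (f : {set T} -> S) : mean 0 f = f finset.set0.
Proof.
rewrite /mean (bigD1 finset.set0) //= [X in _ + X]big1 => [|B].
  by rewrite addr0 /weight big1 ?mul1r // => v _; rewrite inE subr0.
by case/set0Pn => v vB; rewrite /weight (bigD1 v) //= vB !mul0r.
Qed.

(** The value of [f] at [B] minus [v] does not depend on whether [v] belongs to
    [B], which happens not to be the case with probability [1 - x]. *)
Lemma mean_delete (S : comNzRingType) (x : S) (f : {set T} -> S) v :
  (1 - x) * mean x (fun B => f (B :\ v)) = mean x (fun B => (v \notin B)%:R * f B).
Proof.
rewrite -[RHS](_ : mean x (fun B => (if v \in B then 0 else f (B :\ v))) = _).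
  rewrite (@mean_cond _ _ x v (~: [set v])); last 3 first.
  - by rewrite !inE eqxx.
  - by [].
  - by move=> B; rewrite finset.setDE -finset.setIA finset.setIid -finset.setDE.
  by rewrite mean_cst mulr0 add0r.
apply: mean_ext => B; case: ifP => vB /=; first by rewrite mul0r.
by rewrite mul1r; congr f; apply/setDidPl; rewrite disjoint_sym disjoints1 vB.
Qed.

Fact deriv_weight_algebra (S : comNzRingType) (x : S) b c :
  x * (1 - x) * (x ^+ b.-1 *+ b * (1 - x) ^+ c + x ^+ b * (- 1 * (1 - x) ^+ c.-1 *+ c)) =
  (b%:R - (b%:R + c%:R) * x) * (x ^+ b * (1 - x) ^+ c).
Proof.
rewrite -(mulr_natr (x ^+ b.-1)) -(mulr_natr (- 1 * _)).
by case: b => [|b]; case: c => [|c] /=; rewrite ?exprS ?expr0; ring.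
Qed.

Lemma deriv_weight B :
  'X * (1 - 'X) * (weight 'X B)^`() =
  (#|B|%:R - #|T|%:R * 'X) * weight ('X : {poly R}) B.
Proof.
have -> : weight ('X : {poly R}) B = 'X ^+ #|B| * (1 - 'X) ^+ #|~: B|.
  rewrite /weight (bigID (mem B)) /=; congr (_ * _).
    by rewrite -prodr_const; apply: eq_bigr => v ->.
  rewrite -prodr_const; apply: eq_big => v; first by rewrite inE.
  by move=> /negbTE->.
rewrite -(cardsC B) natrD derivM derivXn deriv_exp derivB derivX -polyC1 derivC sub0r.
exact: deriv_weight_algebra.
Qed.

(** Russo's formula. Multiplied by 1 - x, both sides become means over the random
    set: the left one by differentiating the weights x^b (1 - x)^c, the right one by
    counting, for each set, the absent vertices. *)
Lemma russo F : 'X * (mean_poly F)^`() =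
  \sum_v (mean_poly F - mean_poly (fun B => F (B :\ v))).
Proof.
have nz : 1 - 'X != 0 :> {poly R}.
  apply/eqP => /(congr1 (fun p : {poly R} => p.[0])); rewrite hornerD hornerN hornerX.
  by rewrite -polyC1 !hornerC subr0 => /eqP; rewrite oner_eq0.
apply: (mulfI nz); rewrite mulrA [_ * 'X]mulrC /mean_poly {1}/mean raddf_sum mulr_sumr.
transitivity (mean 'X (fun B => (#|B|%:R - #|T|%:R * 'X) * (F B)%:P)).
  apply: eq_bigr => B _ /=; by rewrite derivM derivC mulr0 addr0 mulrA deriv_weight -mulrA mulrCA.
rewrite sumrB sumr_const mulrBr mulr_sumr.
rewrite [X in _ = _ - X](eq_bigr (fun v =>
   mean 'X (fun B => (v \notin B)%:R * (F B)%:P))); last first.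
  by move=> v _; rewrite -mean_delete.
rewrite -[mean _ _ *+ _]mulr_natl.
rewrite [X in _ = _ - X](_ : _ = mean 'X (fun B => #|~: B|%:R * (F B)%:P)); last first.
  rewrite /mean exchange_big /=; apply: eq_bigr => B _.
  rewrite -mulr_sumr -mulr_suml; congr (_ * (_ * _)).
  by rewrite -sum1_card natr_sum [RHS]big_mkcond /=; apply: eq_bigr => v _; rewrite inE; case: (v \in B).
rewrite mulrA -meanZ -meanB; apply: mean_ext => B.
rewrite -mulrBl -(cardsC B) natrD; congr (_ * _).
by rewrite mulrBl mul1r addrAC addrK [_ * 'X]mulrC.
Qed.

(** The functional of a percolation polynomial satisfies the same first-step
    recursion as the probabilities of the cutting procedure. *)
Lemma log_integral_russo F A : F finset.set0 = 0 ->
  #|A|%:R * log_integral (mean_poly (fun B => F (B :&: A))) =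
  F A + \sum_(v in A) log_integral (mean_poly (fun B => F (B :&: (A :\ v)))).
Proof.
move=> F0; have := log_integral_deriv (mean_poly (fun B => F (B :&: A))).
rewrite !horner_mean_poly mean1 mean0 finset.setTI finset.set0I F0 subr0 => <-.
rewrite russo log_integral_sum (bigID (mem A)) /= [X in _ = _ + X + _]big1.
  rewrite addr0 -big_split /= -sumr_const mulr_suml; apply: eq_bigr => v vA.
  rewrite log_integralD log_integralN mul1r.
  rewrite (_ : mean_poly (fun B => F ((B :\ v) :&: A)) = mean_poly (fun B => F (B :&: (A :\ v)))).
    ring.
  by apply: mean_ext => B; congr (F _)%:P; rewrite finset.setIDAC finset.setIDA.
move=> v vA; rewrite (_ : mean_poly (fun B => F ((B :\ v) :&: A)) = mean_poly (fun B => F (B :&: A))).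
  by rewrite subrr log_integral0.
apply: mean_ext => B; congr (F _)%:P; apply/setP => u; rewrite !inE.
by case: eqP => //= ->; rewrite (negbTE vA) andbF.
Qed.
End Russo.

Section Process.
Variables (T : rooted_tree) (R : realType) (m : nat).
Implicit Types (u v w : T) (A B : {set T}) (s : seq T).

Definition separation_after A s : bool :=
  [&& ~~ has_leaf (foldl (@Defs.cut T) A s),
    [forall i : 'I_(size s), has_leaf (foldl (@Defs.cut T) A (take i s))]
    & #|foldl (@Defs.cut T) A s| == m].

Definition stop_prob A i : R :=
  \sum_(s : i.-tuple T | separation_after A s) draw_prob R A s.

Lemma stop_prob0 A : stop_prob A 0 = (~~ has_leaf A && (#|A| == m))%:R.
Proof.
rewrite /stop_prob big_mkcond (big_pred1 [tuple]) => [|s]; last first.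
  by apply/esym/eqP; rewrite [s]tuple0.
rewrite /separation_after /=; have -> : [forall i : 'I_0, has_leaf (foldl (@Defs.cut T) A [::])].
  by apply/forallP => -[].
by case: ifP.
Qed.

Lemma separation_after_cons A v s : separation_after A (v :: s) =
  has_leaf A && separation_after (Defs.cut A v) s.
Proof.
rewrite /separation_after /=; have -> : [forall i : 'I_(size s).+1,
   has_leaf (foldl (@Defs.cut T) A (take i (v :: s)))] =
   has_leaf A && [forall i : 'I_(size s), has_leaf (foldl (@Defs.cut T) (Defs.cut A v) (take i s))].
  apply/forallP/andP => [H|[A0 /forallP H] [[|i] /= lti]] //.
    split; first exact: (H ord0).
    by apply/forallP => -[i lti]; exact: (H (Ordinal (lti : i.+1 < (size s).+1)%N)).
  exact: (H (Ordinal (lti : i < size s)%N)).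
by case: (has_leaf A); rewrite ?andbF.
Qed.

Lemma stop_probS A i : has_leaf A ->
  stop_prob A i.+1 = (\sum_(v in A) stop_prob (Defs.cut A v) i) / #|A|%:R.
Proof.
move=> Al; rewrite /stop_prob.
rewrite (reindex (fun p : T * i.-tuple T => [tuple of p.1 :: p.2])) /=; last first.
  exists (fun s : i.+1.-tuple T => (thead s, [tuple of behead s])) => [[v s] _|s _] /=.
    by congr pair; apply: val_inj.
  by rewrite -tuple_eta.
under eq_bigl do rewrite separation_after_cons Al.
rewrite -(pair_big_dep xpredT (fun v (s : i.-tuple T) => separation_after (Defs.cut A v) s)
   (fun v (s : i.-tuple T) => (v \in A)%:R / #|A|%:R * draw_prob R (Defs.cut A v) s)) /=.
rewrite mulr_suml [RHS]big_mkcond; apply: eq_bigr => v _; rewrite -mulr_sumr.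
by case: ifP => _; rewrite ?mul0r //= mul1r mulrC.
Qed.

Lemma stop_prob_leafless A i : ~~ has_leaf A -> stop_prob A i.+1 = 0.
Proof.
move=> /negbTE Al; rewrite /stop_prob big_pred0 // => s.
by case/tupleP: s => v s; rewrite separation_after_cons Al.
Qed.

(** The coefficient of degree [m] of [separating] at the root, in the form of a
    count, which is how the vertices enter the first step of the procedure. *)
Definition pivots B : R :=
  #|[set v | [&& has_leaf (component Defs.root B), ~~ has_leaf (component Defs.root (B :\ v))
     & #|component Defs.root (B :\ v)| == m]]|%:R.

Definition pivot_integral A : R :=
  log_integral (mean_poly (fun B => pivots (B :&: A))).

Lemma pivots_component A B :
  pivots (B :&: component Defs.root A) = pivots (B :&: A).
Proof.
rewrite /pivots; congr (_%:R); apply: eq_card => v; rewrite !inE.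
by rewrite -!finset.setIDAC !component_restrict.
Qed.

Lemma pivot_integral_component A : pivot_integral (component Defs.root A) = pivot_integral A.
Proof.
by congr log_integral; apply: mean_ext => B; rewrite pivots_component.
Qed.

Lemma pivots_leafless B : ~~ has_leaf (component Defs.root B) -> pivots B = 0.
Proof.
move=> Bl; rewrite /pivots (negbTE Bl).
by apply/eqP; rewrite pnatr_eq0 cards_eq0; apply/eqP/setP => v; rewrite !inE.
Qed.

Lemma pivot_integral_leafless A :
  ~~ has_leaf (component Defs.root A) -> pivot_integral A = 0.
Proof.
move=> Al; rewrite /pivot_integral (_ : mean_poly _ = 0) ?log_integral0 //.
rewrite -[RHS](mean_cst T 'X 0); apply: mean_ext => B; rewrite pivots_leafless //.
by apply: contra Al; apply/has_leafS/componentS/subsetIr.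
Qed.

(** Both sides satisfy the same recursion over the first deleted vertex. The
    hypothesis on [A] holds for every state reached by cutting, and each step
    deletes a vertex, so that [k] steps are enough. *)
Lemma stop_prob_sum A k : component Defs.root A = A -> (#|A| <= k)%N ->
  \sum_(i < k.+1) stop_prob A i =
  if has_leaf A then pivot_integral A else (#|A| == m)%:R.
Proof.
elim: k A => [|k IH] A cA Ak.
  have -> : A = finset.set0 by apply/eqP; rewrite -cards_eq0 -leqn0.
  by rewrite big_ord_recl big_ord0 addr0 stop_prob0 has_leaf0 cards0.
rewrite big_ord_recl stop_prob0; case: ifPn => Al /=; last first.
  by rewrite big1 ?addr0 // => i _; rewrite stop_prob_leafless.
have A0 : #|A|%:R != 0 :> R.
  rewrite pnatr_eq0 cards_eq0; apply: contraTneq Al => ->; by rewrite has_leaf0.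
rewrite add0r; under eq_bigr do rewrite /bump add1n stop_probS //.
rewrite -mulr_suml exchange_big /=; apply: (mulIf A0); rewrite mulfVK // mulrC.
rewrite log_integral_russo; last first.
  by apply: pivots_leafless; rewrite component_out ?inE // has_leaf0.
have -> : pivots A = \sum_(v in A) (~~ has_leaf (Defs.cut A v) && (#|Defs.cut A v| == m))%:R.
  rewrite /pivots cA Al -sum1_card natr_sum big_mkcond [RHS]big_mkcond /=.
  apply: eq_bigr => v _; rewrite inE /= cutE; case: (boolP (v \in A)) => vA.
    by case: (_ && _).
  have -> : A :\ v = A by apply/setDidPl; rewrite disjoint_sym disjoints1.
  by rewrite cA Al.
rewrite -big_split /=; apply: eq_bigr => v vA.
have cc : component Defs.root (Defs.cut A v) = Defs.cut A v.
  by rewrite cutE; have := component_restrict Defs.root (A :\ v) [set: T]; rewrite !finset.setTI.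
rewrite IH //; last first.
  rewrite -ltnS; apply: leq_trans Ak; rewrite cutE.
  apply: leq_ltn_trans (subset_leq_card (component_sub _ _)) _.
  by rewrite [X in (_ < X)%N](cardsD1 v) vA.
rewrite -/(pivot_integral (A :\ v)) -(pivot_integral_component (A :\ v)) -cutE.
case: ifPn => cl /=; first by rewrite add0r.
by rewrite pivot_integral_leafless ?cc // addr0.
Qed.

(** A vertex of maximal height has no children. *)
Lemma has_leafT : has_leaf [set: T].
Proof.
case: (arg_maxnP (@height T) (isT : xpredT Defs.root)) => v _ vmax.
apply/has_leafP; exists v; first by rewrite inE.
apply/set0Pn => -[u uv]; have := vmax u isT.
by rewrite (height_child uv) /=; rewrite ltnn.
Qed.

Lemma separation_size_probE :
  separation_size_prob T R m = log_integral (mean_poly pivots).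
Proof.
transitivity (\sum_(i < #|T|.+1) stop_prob [set: T] i).
  apply: eq_bigr => i _; apply: eq_bigl => s.
  by rewrite /first_separation /separation_after andbA.
rewrite stop_prob_sum; [|exact: below_root|by rewrite cardsT]. rewrite has_leafT.
by congr log_integral; apply: mean_ext => B; rewrite finset.setIT.
Qed.

End Process.

(** * Catalan numbers and central binomial coefficients *)

Section Catalan.
Variable R : realType.

Definition central_bin n : R := 'C(2 * n, n)%:R.
Definition catalan n : R := central_bin n / n.+1%:R.

Lemma central_bin0 : central_bin 0 = 1. Proof. by rewrite /central_bin bin0. Qed.

Lemma central_binS n : n.+1%:R * central_bin n.+1 = (4 * n + 2)%:R * central_bin n.
Proof.
rewrite /central_bin -!natrM; congr (_%:R).
rewrite (_ : 2 * n.+1 = (2 * n).+2)%N; last lia.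
have /= <- := mul_bin_diag (2 * n).+2 n.
have /= := mul_bin_down (2 * n).+1 n; rewrite (_ : (2 * n).+1 - n = n.+1)%N; last lia.
rewrite (_ : (2 * n).+2 = 2 * n.+1)%N; last lia.
rewrite (_ : 4 * n + 2 = 2 * (2 * n).+1)%N; last lia.
by rewrite -!mulnA => ->.
Qed.

(** This linear relation reduces convolutions with Catalan numbers to
    convolutions of central binomial coefficients. *)
Lemma catalanE n : 2 * catalan n = 4 * central_bin n - central_bin n.+1.
Proof.
have := central_binS n; rewrite /catalan natrD natrM.
have n0 : n.+1%:R != 0 :> R by rewrite pnatr_eq0.
move=> e; apply: (mulfI n0); rewrite mulrBr e.
rewrite mulrCA [n.+1%:R * _]mulrCA divff // -[n.+1%:R]natr1; ring.
Qed.

Lemma catalan0 : catalan 0 = 1. Proof. by rewrite /catalan central_bin0 divr1. Qed.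

(** These are the coefficients of (1 - 4 z)^(-1) as the square of
    (1 - 4 z)^(-1/2). Weighting a term of the convolution by its index, which
    by symmetry is worth half the total degree, turns [central_binS] into the recursion
    of the powers of 4. *)
Lemma central_bin_conv n : \sum_(i < n.+1) central_bin i * central_bin (n - i) = 4 ^+ n.
Proof.
elim: n => [|n IH]; first by rewrite big_ord_recl big_ord0 subn0 central_bin0 mulr1 addr0.
have n0 : n.+1%:R != 0 :> R by rewrite pnatr_eq0.
apply: (mulfI n0).
have sym m : \sum_(i < m.+1) (i%:R * (central_bin i * central_bin (m - i))) =
    \sum_(i < m.+1) ((m - i)%:R * (central_bin i * central_bin (m - i))).
  rewrite (reindex_inj rev_ord_inj) /=; apply: eq_bigr => i _.
  by rewrite subSS subKn 1?[central_bin _ * _]mulrC // -ltnS.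
have half m : m%:R * (\sum_(i < m.+1) central_bin i * central_bin (m - i)) =
    2 * \sum_(i < m.+1) (i%:R * (central_bin i * central_bin (m - i))).
  rewrite mulr_sumr mulr_natl mulr2n {2}sym -big_split /=; apply: eq_bigr => i _.
  by rewrite -mulrDl -natrD subnKC // -ltnS.
rewrite half big_ord_recl mul0r add0r.
transitivity (2 * \sum_(i < n.+1) ((4 * i + 2)%:R * (central_bin i * central_bin (n - i)))).
  congr (_ * _); apply: eq_bigr => i _; rewrite lift0 subSS.
  by rewrite mulrA central_binS mulrA.
transitivity (4 * (2 * \sum_(i < n.+1) (i%:R * (central_bin i * central_bin (n - i)))) +
   4 * \sum_(i < n.+1) (central_bin i * central_bin (n - i))).
  rewrite !mulr_sumr -big_split; apply: eq_bigr => i _ /=.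
  rewrite natrD natrM; ring.
by rewrite -half IH exprS -[n.+1%:R]natr1; ring.
Qed.

(** A component of size n + 1 with a marked boundary vertex consists of the root, of a
    component without a mark on one side and of one with a mark on the other. *)
Lemma catalan_central_bin_conv n :
  2 * (\sum_(i < n.+1) catalan i * central_bin (n - i)) = central_bin n.+1.
Proof.
rewrite mulr_sumr.
transitivity (4 * (\sum_(i < n.+1) central_bin i * central_bin (n - i)) -
   \sum_(i < n.+1) central_bin i.+1 * central_bin (n - i)).
  rewrite mulr_sumr -sumrB; apply: eq_bigr => i _.
  by rewrite mulrA catalanE; ring.
rewrite central_bin_conv -exprS -central_bin_conv big_ord_recl /= central_bin0 mul1r subn0.
under [X in _ + X - _]eq_bigr do rewrite /bump add1n subSS.
by rewrite addrK.
Qed.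

Lemma catalan_conv n :
  \sum_(i < n.+1) catalan i * catalan (n - i) = catalan n.+1.
Proof.
have four : 4 != 0 :> R by rewrite pnatr_eq0.
apply: (mulfI four).
transitivity (4 * (2 * \sum_(i < n.+1) catalan i * central_bin (n - i)) -
   (2 * \sum_(i < n.+2) catalan i * central_bin (n.+1 - i)) + 2 * catalan n.+1).
  rewrite [X in _ - 2 * X]big_ord_recr /= subnn central_bin0 mulr1 [2 * (_ + _)]mulrDr opprD addrA subrK.
  rewrite !mulr_sumr -sumrB; apply: eq_bigr => i _.
  have := catalanE (n - i); rewrite -subSn -1?ltnS //.
  set c := catalan (n - i) => e; have {e} : c = (4 * central_bin (n - i) - central_bin (n.+1 - i)) / 2 by lra.
  by move=> ->; field.
by rewrite !catalan_central_bin_conv; have := catalanE n.+1; lra.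
Qed.

End Catalan.

(** * The map of one generation and its fixed point *)

Section Phi.
Variable R : realType.
Implicit Types x d : R.

Lemma phi_cases x : 0 <= x <= 1 ->
  (x <= 1/2 /\ phi x = 0) \/ [/\ 1/2 <= x, 0 <= phi x <= 1 & x * phi x = 2 * x - 1].
Proof.
move=> /andP[x0 x1]; have [xh|xh] := leP x (1/2); [left|right].
  split=> //; rewrite /phi; case: eqVneq => // xn0.
  have x_gt0 : 0 < x by rewrite lt_def xn0.
  apply/max_idPl; rewrite subr_le0.
  by rewrite -[2]invrK lef_pV2 ?posrE ?invr_gt0 //; lra.
have x_gt0 : 0 < x by lra.
have xn0 : x != 0 by rewrite gt_eqF.
have xV : x * x^-1 = 1 by rewrite divff.
have V1 : 1 <= x^-1 by rewrite -[1]invr1 lef_pV2 ?posrE.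
have V2 : x^-1 <= 2 by rewrite -[2]invrK lef_pV2 ?posrE ?invr_gt0 //; lra.
have -> : phi x = 2 - x^-1.
  by rewrite /phi (negbTE xn0); apply/max_idPr; lra.
by split; [lra|lra|rewrite mulrBr xV mulrC].
Qed.

Lemma phi_fix x : 0 <= x <= 1 -> phi x = x * (2 * phi x - phi x ^+ 2).
Proof.
move=> x01; have [[_ ->]|[xh ph e]] := phi_cases x01; first by rewrite expr0n /=; ring.
rewrite (_ : x * _ = 2 * (x * phi x) - (x * phi x) * phi x); last by ring.
by rewrite e mulrBl -mulrA e; ring.
Qed.

(** The lower bound by a quarter of phi is kept along the iteration. It is what
    makes errors from below decrease: near x = 1/2 the fixed points phi and 0 of
    the one-step map merge, and the iteration must stay away from 0. *)
Definition near_phi x d (p : R) : bool :=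
  [&& phi x / 4 <= p, p <= 1, phi x - d <= p & p <= phi x + d].

(** With p = phi + t the one-step map has error t x (2 - 2 phi - t), and
    x (2 - phi) = 1 when phi is positive; so the error is multiplied by
    1 - x (phi + t). *)
Lemma near_phi_step x d p q : 0 <= x <= 1 -> 0 <= d <= 1 ->
  near_phi x d p -> near_phi x d q ->
  near_phi x (d - d ^+ 2 / 8) (x * (1 - (1 - p) * (1 - q))).
Proof.
move=> x01 d01 /and4P[p1 p2 p3 p4] /and4P[q1 q2 q3 q4].
have fx := phi_fix x01.
have ph : 0 <= phi x <= 1 by have [[_ ->]|[]] := phi_cases x01; lra.
rewrite /near_phi; have := phi_cases x01; move: (phi x) fx ph p1 q1 p3 q3 p4 q4.
move=> f fx f01 p1 q1 p3 q3 p4 q4 fcase.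
have down r : 0 <= r <= 1 -> r <= p -> r <= q ->
    x * (2 * r - r ^+ 2) <= x * (1 - (1 - p) * (1 - q)).
  move=> r01 rp rq; apply: ler_wpM2l; first lra.
  have h1 : 0 <= (1 - r) * (p - r) by apply: mulr_ge0; lra.
  have h2 : 0 <= (1 - p) * (q - r) by apply: mulr_ge0; lra.
  lra.
have up r : 0 <= r <= 1 -> p <= r -> q <= r ->
    x * (1 - (1 - p) * (1 - q)) <= x * (2 * r - r ^+ 2).
  move=> r01 rp rq; apply: ler_wpM2l; first lra.
  have h1 : 0 <= (1 - r) * (r - p) by apply: mulr_ge0; lra.
  have h2 : 0 <= (1 - p) * (r - q) by apply: mulr_ge0; lra.
  lra.
have mono t : 0 <= t <= d -> t - t ^+ 2 / 8 <= d - d ^+ 2 / 8.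
  move=> td; have h : 0 <= (d - t) * (8 - (d + t)) by apply: mulr_ge0; lra.
  lra.
apply/and4P; split.
- apply: le_trans (down (f / 4) _ p1 q1); last lra.
  case: fcase => [[_ ->]|[xh _ e]]; first by rewrite mul0r expr0n /= !(mulr0, subr0).
  rewrite (_ : x * _ = f / 4 * (2 * x - x * f) + 3 / 16 * f * (x * f)); last by field.
  rewrite e; have h : 0 <= f * (2 * x - 1) by apply: mulr_ge0; lra.
  lra.
- have h : 0 <= x * ((1 - p) * (1 - q)) by do ?apply: mulr_ge0; lra.
  lra.
- pose t := Num.min d (3 / 4 * f).
  have [td tf] : t <= d /\ t <= 3 / 4 * f by rewrite /t; case: (leP d (3 / 4 * f)) => ?; do ?split; lra.
  have t0 : 0 <= t by rewrite /t; case: (leP d (3 / 4 * f)) => ?; do ?split; lra.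
  have [tp tq] : f - t <= p /\ f - t <= q by rewrite /t; case: (leP d (3 / 4 * f)) => ?; do ?split; lra.
  apply: (le_trans _ (down (f - t) _ tp tq)); last lra.
  have := mono t; rewrite t0 td => /(_ isT) mt.
  rewrite (_ : x * _ = x * (2 * f - f ^+ 2) - t * (x * (2 - 2 * f + t))); last by ring.
  rewrite -fx; suff h : t * (x * (2 - 2 * f + t)) <= t * (1 - t / 8) by lra.
  apply: ler_wpM2l => //; case: fcase => [[xh f0]|[xh _ e]]; first by nra.
  have h : 0 <= (x - 1 / 2) * (f - t) by apply: mulr_ge0; lra.
  lra.
- pose t := Num.min d (1 - f).
  have [td tf] : t <= d /\ t <= 1 - f by rewrite /t; case: (leP d (1 - f)) => ?; do ?split; lra.
  have t0 : 0 <= t by rewrite /t; case: (leP d (1 - f)) => ?; do ?split; lra.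
  have [tp tq] : p <= f + t /\ q <= f + t by rewrite /t; case: (leP d (1 - f)) => ?; do ?split; lra.
  apply: (le_trans (up (f + t) _ tp tq)); first lra.
  have := mono t; rewrite t0 td => /(_ isT) mt.
  rewrite (_ : x * _ = x * (2 * f - f ^+ 2) + t * (x * (2 - 2 * f - t))); last by ring.
  rewrite -fx; suff h : t * (x * (2 - 2 * f - t)) <= t * (1 - t / 8) by lra.
  apply: ler_wpM2l => //; case: fcase => [[xh f0]|[xh _ e]].
    have h : 0 <= (1 / 2 - x) * (2 - t) by apply: mulr_ge0; lra.
    rewrite f0; lra.
  have h : 0 <= (x - 1 / 2) * t by apply: mulr_ge0; lra.
  lra.
Qed.

(** A sequence starting at 1 and decreasing more slowly than
    d |-> d - d^2 / 8. *)
Definition rate k : R := 8 / (k + 8)%:R.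

Lemma rateP k : 0 < rate k <= 1.
Proof.
have k8 : 8 <= (k + 8)%:R :> R by rewrite ler_nat leq_addl.
rewrite /rate; apply/andP; split; first by apply: divr_gt0; lra.
by rewrite ler_pdivrMr ?mul1r //; lra.
Qed.

Lemma rateS k : rate k - rate k ^+ 2 / 8 <= rate k.+1.
Proof.
rewrite /rate addSn -[(k + 8).+1%:R]natr1; set a : R := (k + 8)%:R.
have a0 : 0 < a by rewrite ltr0n addnS.
rewrite (_ : _ - _ = 8 * (a - 1) / a ^+ 2); last by field; rewrite gt_eqF.
rewrite ler_pdivrMr ?exprn_gt0 // mulrAC ler_pdivlMr ?addr_gt0 //; nra.
Qed.

Lemma near_phiW x d d' p : d <= d' -> near_phi x d p -> near_phi x d' p.
Proof. by move=> dd' /and4P[p1 p2 p3 p4]; apply/and4P; split => //; lra. Qed.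

Lemma rate_mono k l : (k <= l)%N -> rate l <= rate k.
Proof.
move=> kl; rewrite /rate ler_pM2l ?lef_pV2 ?posrE ?ltr0n ?addnS //.
by rewrite ler_nat !ltnS leq_add2r.
Qed.

End Phi.

(** * Trees that branch in two for many generations *)

Section Binary.
Variable T : rooted_tree.
Implicit Types u v w : T.

(** Below [w] every vertex has two children for [k] generations. A vertex of the
    generation reached then is a leaf or has a leaf among its children, so that p is
    at least x^2 there: this is the shape of a complete tree just above its last
    level. *)
Fixpoint binary_depth (k : nat) w : Prop :=
  if k is k'.+1 then
    exists u1 u2, [/\ u1 != u2, children w = [set u1; u2],
      binary_depth k' u1 & binary_depth k' u2]
  else leaf w \/ exists2 u, u \in children w & leaf u.

Lemma binary_leafF k w : binary_depth k.+1 w -> leaf w = false.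
Proof.
case=> u1 [u2 [_ cw _ _]]; apply/negbTE/set0Pn; exists u1; by rewrite cw !inE eqxx.
Qed.

Variable R : realType.
Variable x : R.

Definition percolates w : R := 1 - mean_leafless x 1 w.

Lemma percolatesE w : percolates w =
  if leaf w then x else x * (1 - \prod_(u in children w) (1 - percolates u)).
Proof.
rewrite /percolates mean_leaflessE; case: ifP => _; first by ring.
rewrite [X in _ = x * (1 - X)](eq_bigr (mean_leafless x 1)); first by ring.
by move=> u _; ring.
Qed.

Lemma percolates_bounds w : 0 <= x <= 1 -> 0 <= percolates w <= x.
Proof.
move=> x01; elim/tree_ind: w => w IH; rewrite percolatesE; case: ifP => _; first by lra.
have : 0 <= \prod_(u in children w) (1 - percolates u) <= 1.
  by apply/andP; split; [apply: prodr_ge0|apply: prodr_ile1] => u uw; have ? := IH u uw; lra.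
move: (\prod_(_ in _) _) => c /andP[c0 c1].
have h1 : 0 <= x * c by apply: mulr_ge0; lra.
have h2 : 0 <= x * (1 - c) by apply: mulr_ge0; lra.
lra.
Qed.

Lemma percolates_two w u1 u2 : u1 != u2 -> children w = [set u1; u2] ->
  percolates w = x * (1 - (1 - percolates u1) * (1 - percolates u2)).
Proof.
move=> u12 cw; rewrite percolatesE; have -> : leaf w = false.
  by apply/negbTE/set0Pn; exists u1; rewrite cw !inE eqxx.
by rewrite cw big_setU1 ?big_set1 // inE.
Qed.

(** A kept vertex with a kept leaf below it is joined to a leaf. *)
Lemma percolates_base w : 0 <= x <= 1 -> binary_depth 0 w -> x ^+ 2 <= percolates w.
Proof.
move=> x01 [wl|[u uw ul]]; rewrite percolatesE.
  have h : 0 <= x * (1 - x) by apply: mulr_ge0; lra.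
  rewrite wl; lra.
have -> : leaf w = false by apply/negbTE/set0Pn; exists u.
rewrite (bigD1 u) //= percolatesE ul.
have : 0 <= \prod_(v in children w | v != u) (1 - percolates v) <= 1.
  apply/andP; split; [apply: prodr_ge0|apply: prodr_ile1] => v _;
  have ? := percolates_bounds v x01; lra.
move: (\prod_(_ in _ | _) _) => c /andP[c0 c1].
have h1 : 0 <= x * ((1 - x) * (1 - c)) by do ?apply: mulr_ge0; lra.
lra.
Qed.

Lemma percolates_near k w : 0 <= x <= 1 -> binary_depth k w -> near_phi x (rate R k) (percolates w).
Proof.
move=> x01; elim: k w => [|k IH] w.
  move=> /(percolates_base x01) p2; have := percolates_bounds w x01.
  have -> : rate R 0 = 1 by rewrite /rate add0n divff // pnatr_eq0.
  move=> p1; have [[xh f0]|[xh f01 e]] := phi_cases x01; apply/and4P.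
    by split; rewrite ?f0; lra.
  have h : 0 <= (x - 1 / 2) * (x + 1 / 2) by apply: mulr_ge0; lra.
  by split; lra.
case=> u1 [u2 [u12 cw /IH b1 /IH b2]]; rewrite (percolates_two u12 cw).
apply: near_phiW (rateS R k) _; apply: near_phi_step => //.
by have ? := rateP R k; lra.
Qed.

Lemma percolates_dist k w : 0 <= x <= 1 -> binary_depth k w -> `|percolates w - phi x| <= rate R k.
Proof.
by move=> x01 /(percolates_near x01)/and4P[_ _ p3 p4]; rewrite ler_norml; lra.
Qed.

(** The factor [x] on the right makes division by [x] harmless near 0. *)
Lemma percolates_dist_lin k w : 0 <= x <= 1 -> binary_depth k.+1 w ->
  `|percolates w - phi x| <= 2 * x * rate R k.
Proof.
move=> x01 [u1 [u2 [u12 cw b1 b2]]]; rewrite (percolates_two u12 cw).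
have := percolates_dist x01 b1; have := percolates_dist x01 b2.
have := percolates_bounds u1 x01; have := percolates_bounds u2 x01.
have f01 : 0 <= phi x <= 1 by have [[_ ->]|[]] := phi_cases x01; lra.
rewrite {3}(phi_fix x01); move: f01; move: (phi x) (rate R k) (percolates u1) (percolates u2).
move=> f r p q f01 q01 p01 dq dp.
rewrite (_ : _ - _ = x * ((p - f) * (1 - q) + (q - f) * (1 - f))); last by ring.
rewrite normrM [2 * x]mulrC -mulrA ger0_norm; last lra.
apply: ler_wpM2l; first lra.
apply: le_trans (ler_normD _ _) _; rewrite !normrM.
rewrite [`|1 - q|]ger0_norm; last lra.
rewrite [`|1 - f|]ger0_norm; last lra.
have h1 : 0 <= `|p - f| * q by apply: mulr_ge0 => //; lra.
have h2 : 0 <= `|q - f| * f by apply: mulr_ge0 => //; lra.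
lra.
Qed.

Lemma leafless_coef0 (w : T) : (mean_leafless x%:P 'X w)`_0 = 1 - x.
Proof.
rewrite mean_leaflessE coefD coefB coefC /= -polyC1 coefC /=.
by case: ifP => _; rewrite ?coef0 ?addr0 // -!mulrA coefCM coefXM mulr0 addr0.
Qed.

(** A leafless component of size [j] is one of the C_j binary trees with [j]
    nodes, all of them kept, with its [j + 1] boundary vertices deleted. *)
Lemma leafless_coef k w j : binary_depth k w -> (j <= k)%N ->
  (mean_leafless x%:P 'X w)`_j = catalan R j * x ^+ j * (1 - x) ^+ j.+1.
Proof.
elim: k w j => [|k IH] w [|j] //; rewrite ?leafless_coef0 ?catalan0 ?expr0 ?expr1 ?mul1r //.
move=> bw jk; have wl := binary_leafF bw; case: bw => u1 [u2 [u12 cw b1 b2]].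
rewrite mean_leaflessE wl cw big_setU1 ?big_set1 ?inE //.
have shift (q : {poly R}) : (x%:P * 'X * q)`_j.+1 = x * q`_j.
  by rewrite -mulrA coefCM coefXM.
rewrite coefD coefB coef1 coefC subrr add0r shift coefM.
rewrite -catalan_conv mulr_sumr !mulr_suml; apply: eq_bigr => i _.
have ij : (i <= j)%N by rewrite -ltnS.
have -> : x ^+ j.+1 = x * (x ^+ i * x ^+ (j - i)) by rewrite -exprD subnKC // exprS.
have -> : (1 - x) ^+ j.+2 = (1 - x) ^+ i.+1 * (1 - x) ^+ (j - i).+1.
  by rewrite -exprD addnS addSn subnKC.
by rewrite !IH //; [ring|lia|lia].
Qed.

Lemma mean_leafless_polyC w : mean_leafless x%:P 1 w = (mean_leafless x 1 w)%:P.
Proof.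
elim/tree_ind: w => w IH; rewrite !mean_leaflessE !polyCD polyCN polyC1.
case: ifP => _ //; rewrite !polyCM polyC1 rmorph_prod; congr (_ + _ * _).
exact: eq_bigr.
Qed.

Lemma separating_coef0 k w : binary_depth k.+1 w ->
  (mean_separating x%:P 'X w)`_0 = percolates w.
Proof.
case=> u1 [u2 [u12 cw b1 b2]]; rewrite (mean_separatingE _ _ u12 cw).
rewrite (percolates_two u12 cw) coefD -(mulrA _ 'X) !coefCM coefXM mulr0 addr0.
rewrite !mean_leafless_polyC coefB coef1 -polyCM coefC /= /percolates; ring.
Qed.

Lemma separating_coefS k w j : binary_depth k.+1 w ->
  exists u1 u2, [/\ binary_depth k u1, binary_depth k u2 &
  (mean_separating x%:P 'X w)`_j.+1 = x * \sum_(i < j.+1)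
    ((mean_separating x%:P 'X u1)`_i * (mean_leafless x%:P 'X u2)`_(j - i) +
     (mean_separating x%:P 'X u2)`_i * (mean_leafless x%:P 'X u1)`_(j - i))].
Proof.
case=> u1 [u2 [u12 cw b1 b2]]; exists u1, u2; split=> //.
rewrite (mean_separatingE _ _ u12 cw).
rewrite coefD -(mulrA _ 'X) !coefCM coefXM /= !mean_leafless_polyC coefB coef1 -polyCM coefC subrr mulr0 add0r.
by rewrite [_ * mean_separating _ _ u2]mulrC coefD !coefM -big_split.
Qed.

(** Each of the binomial(2 j, j) pairs of a component of size [j] and a boundary
    vertex v contributes x^j (1 - x)^j p[v](x), where v lies at most [j] generations
    below [w] and so still has at least [k - j] regular generations below it. *)
Lemma separating_coef k w j : 0 <= x <= 1 -> (j < k)%N -> binary_depth k w ->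
  `|(mean_separating x%:P 'X w)`_j - central_bin R j * x ^+ j * (1 - x) ^+ j * phi x| <=
  central_bin R j * x ^+ j.+1 * (1 - x) ^+ j * (2 * rate R (k - j.+1)).
Proof.
move=> x01; elim/ltn_ind: j k w => -[|j] IH [|k] w // jk bw.
  rewrite (separating_coef0 bw) central_bin0 !expr0 !mul1r mulr1 expr1 subSS subn0.
  by rewrite mulrCA mulrA; apply: percolates_dist_lin.
have [u1 [u2 [b1 b2 ->]]] := separating_coefS j bw.
have xj i : (i <= j)%N -> x * (x ^+ i * x ^+ (j - i)) = x ^+ j.+1.
  by move=> ij; rewrite -exprD subnKC // exprS.
have yj i : (i <= j)%N -> (1 - x) ^+ i * (1 - x) ^+ (j - i).+1 = (1 - x) ^+ j.+1.
  by move=> ij; rewrite -exprD addnS subnKC.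
rewrite -catalan_central_bin_conv.
rewrite (_ : 2 * _ = \sum_(i < j.+1) 2 * (central_bin R i * catalan R (j - i))); last first.
  rewrite mulr_sumr (reindex_inj rev_ord_inj) /=; apply: eq_bigr => i _.
  by rewrite subSS subKn 1?[catalan _ _ * _]mulrC // -ltnS.
rewrite !mulr_suml mulr_sumr -sumrB; apply: le_trans (ler_norm_sum _ _ _) _.
apply: ler_sum => i _; have ij : (i <= j)%N by rewrite -ltnS.
rewrite (leafless_coef b1) ?(leafless_coef b2); try lia.
set c := catalan R (j - i); have c0 : 0 <= c by rewrite divr_ge0.
have e1 := IH i (ltn_ord i) k u1 (leq_ltn_trans ij jk) b1.
have e2 := IH i (ltn_ord i) k u2 (leq_ltn_trans ij jk) b2.
move: e1 e2; set a1 := _`_i; set a2 := _`_i; set L := central_bin R i * _ * _ * _.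
set r := rate R (k - i.+1) => e1 e2.
have rr : r <= rate R (k.+1 - j.+2) by apply: rate_mono; lia.
pose y := x * (c * x ^+ (j - i) * (1 - x) ^+ (j - i).+1).
have y0 : 0 <= y by rewrite /y; do ?apply: mulr_ge0; rewrite ?exprn_ge0 //; lra.
rewrite (_ : _ - _ = y * ((a1 - L) + (a2 - L))); last first.
  by rewrite -(xj i ij) -(yj i ij) /y /L; ring.
rewrite normrM ger0_norm //.
apply: le_trans (ler_wpM2l y0 (ler_normD _ _)) _.
apply: le_trans (ler_wpM2l y0 (lerD e1 e2)) _.
rewrite (_ : y * _ = 2 * (central_bin R i * c) * x ^+ j.+2 * (1 - x) ^+ j.+1 * (2 * r)); last first.
  by rewrite [x ^+ j.+2]exprS -(xj i ij) -(yj i ij) /y [x ^+ i.+1]exprS; ring.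
apply: ler_wpM2l; last by lra.
have b0 : 0 <= central_bin R i by exact: ler0n.
have px : 0 <= x ^+ j.+2 by apply: exprn_ge0; lra.
have py : 0 <= (1 - x) ^+ j.+1 by apply: exprn_ge0; lra.
apply: mulr_ge0 py; apply: mulr_ge0 px.
by apply: mulr_ge0 => //; apply: mulr_ge0.
Qed.

End Binary.

(** * The trees given by level widths branch in two down to the last level *)

Section LevelTrees.
Variables (d : nat) (w : nat -> nat).
Hypotheses (d_gt0 : (0 < d)%N) (w0 : w 0%N = 1%N).
Hypothesis w_half : forall k j, (k.+1 < d)%N -> (j < w k.+1)%N -> (j./2 < w k)%N.

Let T := level_tree d_gt0 w0 w_half.

(** Comparing vertices through height and horizontal position avoids the
    dependent type of the second component. *)
Definition position (v : T) : nat * nat :=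
  let: existT k j := (v : level_vertex d w) in (nat_of_ord k, nat_of_ord j).

Lemma position_inj : injective position.
Proof.
move=> [k j] [k' j'] /= [] /val_inj kk'; move: j'; rewrite -kk' => j' /val_inj->.
by [].
Qed.

Definition at_position k j (kd : (k < d)%N) (jw : (j < w k)%N) : T :=
  existT (fun k : 'I_d => 'I_(w k)) (Ordinal kd) (Ordinal jw).

Lemma position_parent (v : T) : position (parent v) = ((position v).1.-1, (position v).2./2).
Proof.
case: v => -[[|k] kd] j //=; suff -> : nat_of_ord j = 0%N by [].
by case: j => -[|j] //=; rewrite w0.
Qed.

Lemma position_root (v : T) : (v == Defs.root) = ((position v).1 == 0%N).
Proof.
apply/eqP/eqP => [->//|]; case: v => -[[|k] kd] j //= _; apply: position_inj => /=.
congr pair; case: j => -[|j] //=; by rewrite w0.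
Qed.

Lemma position_child (u v : T) : (u \in children v) =
  ((position u).1 == (position v).1.+1) && ((position u).2./2 == (position v).2).
Proof.
rewrite inE position_root -(inj_eq position_inj) position_parent -pair_eqE /=.
by case: (position u).1 => [|k] //=.
Qed.

Lemma position_bound (v : T) : ((position v).1 < d)%N /\ ((position v).2 < w (position v).1)%N.
Proof. by case: v => k j /=; split. Qed.

Lemma level_tree_binary : (forall k, (k.+1 < d)%N -> w k = (2 ^ k)%N) ->
  forall k (v : T), ((position v).1 + k.+2 = d)%N -> binary_depth k v.
Proof.
move=> full; elim=> [|k IH] v hv /=; have [_ vb] := position_bound v.
  have leafE (u : T) : (position u).1 = (position v).1.+1 -> leaf u.
    move=> hu; apply/set0Pn => -[a]; rewrite position_child hu => /andP[/eqP ha _].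
    by have [] := position_bound a; lia.
  have vd : ((position v).1.+1 < d)%N by lia.
  have [jw|jw] := ltnP (position v).2.*2 (w (position v).1.+1).
    right; exists (at_position vd jw); last exact: leafE.
    by rewrite position_child /= eqxx doubleK eqxx.
  left; apply/set0Pn => -[a]; rewrite position_child => /andP[/eqP ha /eqP ha2].
  have [_] := position_bound a; rewrite ha; move: jw ha2; lia.
have vd : ((position v).1.+1 < d)%N by lia.
have vw : ((position v).2 < 2 ^ (position v).1)%N by rewrite -full //; lia.
have wS : w (position v).1.+1 = (2 * 2 ^ (position v).1)%N by rewrite full ?expnS //; lia.
have j0 : ((position v).2.*2 < w (position v).1.+1)%N by rewrite wS; lia.
have j1 : ((position v).2.*2.+1 < w (position v).1.+1)%N by rewrite wS; lia.
exists (at_position vd j0), (at_position vd j1); split.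
- by rewrite -(inj_eq position_inj) -pair_eqE /= eqxx neq_ltn ltnSn.
- apply/setP => u; rewrite position_child !inE -!(inj_eq position_inj) -!pair_eqE /=.
  rewrite -andb_orr; congr (_ && _); apply/eqP/orP => [<-|[]/eqP->]; last 2 first.
  + by rewrite doubleK.
  + by rewrite /= uphalf_double.
  have := odd_double_half (position u).2; case: (odd _) => /= e; [right|left]; apply/eqP; lia.
- by apply: IH => /=; lia.
- by apply: IH => /=; lia.
Qed.

Lemma level_tree_binary_root k : (forall k, (k.+1 < d)%N -> w k = (2 ^ k)%N) ->
  k.+2 = d -> binary_depth k (Defs.root : T).
Proof. by move=> full kd; apply: level_tree_binary. Qed.

End LevelTrees.

Lemma complete_tree_binary n (n_gt0 : (0 < n)%N) k : trunc_log 2 n = k.+1 ->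
  binary_depth k (Defs.root : complete_tree n_gt0).
Proof.
move=> kn; apply: level_tree_binary_root; last by rewrite kn.
by move=> i; rewrite ltnS /complete_width => ->.
Qed.

Lemma full_tree_binary n (n_gt0 : (0 < n.+2)%N) :
  binary_depth n (Defs.root : full_tree n_gt0).
Proof. exact: level_tree_binary_root. Qed.

(** * Integration and convergence *)

Section Integrals.
Local Open Scope classical_set_scope.
Variable R : realType.
Notation mu := (@lebesgue_measure R).

Lemma segment_integrable (f : R -> R) :
  {within `[0%R, 1%R], continuous f} -> mu.-integrable `[0%R, 1%R] (EFin \o f).
Proof. by apply: continuous_compact_integrable; exact: segment_compact. Qed.

Lemma horner_within (q : {poly R}) : {within `[0%R, 1%R], continuous (horner q)}.
Proof. by apply: continuous_subspaceT; exact: continuous_horner. Qed.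

Lemma log_integralE (q : {poly R}) :
  log_integral (q * 'X) = \int[mu]_(x in `[0%R, 1%R]) q.[x].
Proof.
have dq : deriv (log_prim (q * 'X)) = q.
  apply/polyP => i; rewrite coef_deriv coef_log_prim coefMX /=.
  by rewrite -[_ *+ i.+1]mulr_natr mulfVK // pnatr_eq0.
have l0 : (log_prim (q * 'X)).[0] = 0.
  by rewrite horner_coef0 coef_log_prim coefMX /= mul0r.
rewrite /Rintegral (@continuous_FTC2 _ _ (horner (log_prim (q * 'X)))) //.
- by rewrite l0 sube0.
- exact: horner_within.
- split; first by move=> x _; exact: derivable_horner.
    by apply: cvg_at_right_filter; exact: continuous_horner.
  by apply: cvg_at_left_filter; exact: continuous_horner.
- by move=> x _; rewrite -derivE dq.
Qed.

(** After division by x the bound gives |p(x) / x - f(x)| <= e away from 0, a point of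
    measure zero. *)
Lemma log_integral_dist (p : {poly R}) (f : R -> R) (e : R) :
  {within `[0%R, 1%R], continuous f} -> p.[0] = 0 -> 0 <= e ->
  (forall x, 0 < x <= 1 -> `|p.[x] - x * f x| <= x * e) ->
  `|log_integral p - \int[mu]_(x in `[0%R, 1%R]) f x| <= e.
Proof.
move=> fc p0 e0 pf.
have [q pq] : exists q, p = q * 'X.
  have /factor_theorem[q ->] : poly.root p 0 by apply/eqP.
  by exists q; rewrite subr0.
rewrite pq log_integralE -RintegralB //; try exact: segment_integrable; last first.
  by apply/segment_integrable/horner_within.
pose g x := q.[x] - f x.
have gi : mu.-integrable `[0%R, 1%R] (EFin \o g).
  apply: segment_integrable => x; apply: cvgB; last exact: fc.
  exact: horner_within.
have gi' : mu.-integrable `]0%R, 1%R] (EFin \o g).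
  by apply: integrableS gi => //; apply: subset_itvr; rewrite bnd_simp.
rewrite -(Rintegral_itv_obnd_cbnd (f := g)) //.
apply: le_trans (le_normr_Rintegral _ gi') _ => //.
have len : fine (mu `]0%R, 1%R]) = 1 :> R.
  by rewrite lebesgue_measure_itv /= lte_fin ltr01 /= oppr0 addr0.
have -> : e = \int[mu]_(x in `]0%R, 1%R]) e by rewrite Rintegral_cst // len mulr1.
apply: le_Rintegral => //.
- exact: integrable_norm.
- apply: integrableS (segment_integrable (f := cst e) _) => //.
    by apply: subset_itvr; rewrite bnd_simp.
  by apply: continuous_subspaceT => y; exact: cvg_cst.
move=> x; rewrite /= in_itv /= => /andP[x0 x1].
have := pf x; rewrite x0 x1 pq hornerM hornerX => /(_ isT).
by rewrite mulrC -mulrBr normrM (gtr0_norm x0) ler_pM2l.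
Qed.


Definition limit_density m (x : R) : R := x ^ (m%:Z - 1) * (1 - x) ^+ m * phi x.

Lemma limit_density_mul m x : 0 < x ->
  x * limit_density m x = x ^+ m * (1 - x) ^+ m * phi x.
Proof.
move=> x0; rewrite /limit_density !mulrA; congr (_ * _ * _).
by rewrite -{1}[x]expr1z -expfzDr ?gt_eqF // addrC subrK.
Qed.

(** The density vanishes between 0 and 1/2 because of phi, so that 1 / x can be
    replaced in it by 1 / max(x, 1/2), which is continuous. *)
Lemma limit_density_continuous m : {within `[0%R, 1%R], continuous (limit_density m)}.
Proof.
pose M (x : R) := Num.max x (1 / 2).
have M0 x : M x != 0 by rewrite gt_eqF // lt_max; apply/orP; right; lra.
pose f x := M x ^+ m * (1 - x) ^+ m * (2 - (M x)^-1) * (M x)^-1.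
apply: (@subspace_eq_continuous _ _ _ f).
  move=> x /set_mem /=; rewrite in_itv /= => x01; rewrite /from_subspace /f /M.
  have [[xh p0]|[xh _ px]] := phi_cases x01.
    rewrite /limit_density p0 mulr0 (max_idPr xh) (_ : (1 / 2)^-1 = 2); last by field.
    by rewrite subrr mulr0 mul0r.
  have x0 : x != 0 by rewrite gt_eqF //; lra.
  rewrite (max_idPl xh); apply: (mulfI x0); rewrite limit_density_mul; last lra.
  rewrite mulrCA mulfV // mulr1; congr (_ * _); apply: (mulfI x0); rewrite px.
  by field.
apply: continuous_subspaceT => x.
have cM : {for x, continuous M}.
  by apply: continuous_max; [exact: cvg_id|exact: cvg_cst].
have cV : {for x, continuous (fun y => (M y)^-1)} by apply: continuousV.
have cMm := continuous_comp cM (@exprn_continuous _ m (M x)).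
have c1m := @continuous_onemXn R m x.
have c2V : {for x, continuous (fun y => 2 - (M y)^-1)}.
  by apply: cvgB; [exact: cvg_cst|exact: cV].
exact: (continuousM (continuousM (continuousM cMm c1m) c2V) cV).
Qed.

End Integrals.

Section Limits.
Variable R : realType.
Notation mu := (@lebesgue_measure R).

Lemma horner_coef_mean (T : finType) (x : R) (f : {set T} -> {poly R}) m :
  (mean x%:P f)`_m = mean x (fun B => (f B)`_m).
Proof.
rewrite /mean coef_sum; apply: eq_bigr => B _.
rewrite (_ : weight x%:P B = (weight x B)%:P) ?coefCM //.
rewrite /weight rmorph_prod; apply: eq_bigr => v _.
by case: ifP => _ //; rewrite rmorphB rmorph1.
Qed.

Lemma separating_pivots (T : rooted_tree) m (B : {set T}) :
  (separating ('X : {poly R}) Defs.root B)`_m = pivots R m B.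
Proof.
rewrite /separating /pivots -sum1_card natr_sum [RHS]big_mkcond /=.
rewrite /leafless expr1n mulr1.
case: (has_leaf (component _ B)) => /=; last first.
  by rewrite subrr mul0r coef0 big1 // => v _; rewrite inE.
rewrite subr0 mul1r coef_sum; apply: eq_bigr => v _; rewrite inE.
rewrite -[(~~ _)%:R]/(_%:R) mulr_natl coefMn coefXn eq_sym.
by case: (has_leaf _) => //=; case: eqP.
Qed.

Lemma separation_dist (T : rooted_tree) k m : (m < k)%N -> binary_depth k (Defs.root : T) ->
  `|separation_size_prob T R m - central_bin R m * \int[mu]_(x in `[0%R, 1%R]%classic) limit_density m x|
  <= central_bin R m * (2 * rate R (k - m.+1)).
Proof.
move=> mk bk; have b0 : 0 <= central_bin R m by exact: ler0n.
rewrite separation_size_probE -RintegralZl //; last first.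
  exact/segment_integrable/limit_density_continuous.
apply: log_integral_dist.
- move=> x; apply: cvgM; [exact: cvg_cst|exact: limit_density_continuous].
- by rewrite horner_mean_poly mean0 pivots_leafless // component_out ?inE // has_leaf0.
- by rewrite mulr_ge0 // mulr_ge0 // ltW //; case/andP: (rateP R (k - m.+1)).
move=> x x01; have x01' : 0 <= x <= 1 by lra.
rewrite mulrCA limit_density_mul; last lra.
rewrite horner_mean_poly -(mean_ext _ (@separating_pivots T m)) -horner_coef_mean.
have h := separating_coef x01' mk bk.
rewrite [_ * (_ * _ * phi x)]mulrA [_ * (x ^+ m * _)]mulrA.
apply: (le_trans h); set r := 2 * _.
have r0 : 0 <= r by rewrite mulr_ge0 // ltW //; case/andP: (rateP R (k - m.+1)).
rewrite (_ : central_bin R m * _ * _ * _ = x * (central_bin R m * r) * (x ^+ m * (1 - x) ^+ m)); last first.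
  by rewrite exprS; ring.
apply: ler_piMr; first by do 2?apply: mulr_ge0 => //; lra.
by apply: mulr_ile1; rewrite ?exprn_ge0 ?exprn_ile1 //; lra.
Qed.

Lemma rate_small (e : R) : 0 < e -> exists K, forall k, (K <= k)%N -> rate R k <= e.
Proof.
move=> e0; exists (Num.bound (8 / e)) => k Kk.
have k0 : 0 < (k + 8)%:R :> R by rewrite ltr0n addnS.
rewrite /rate ler_pdivrMr // mulrC -ler_pdivrMr //.
apply: le_trans (ltW (archi_boundP _)) _; first by rewrite divr_ge0 // ltW.
by rewrite ler_nat; apply: leq_trans Kk (leq_addr _ _).
Qed.

(** The only property of the two sequences of trees that the limits depend on. *)
Definition binary_depth_cvg (t : nat -> rooted_tree) : Prop :=
  forall K, exists N, forall n, (N <= n)%N ->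
    exists2 k, (K <= k)%N & binary_depth k (Defs.root : t n).

Local Open Scope classical_set_scope.

Lemma tree_poly_cvg t : binary_depth_cvg t ->
  {uniform `[0%R, 1%R],
    (fun (n : nat) (x : R) => (map_poly intr (tree_poly (t n))).[x]) @ \oo
    --> (@phi R : R -> R)}.
Proof.
move=> ht P /uniform_nbhs[E [entE sE]].
move: entE; rewrite -entourage_ballE => -[e /= e0 be].
have [K Kk] := rate_small (divr_gt0 e0 (ltr0Sn R 1)).
have [N Nn] := ht K.
apply: filterS (nbhs_infty_ge N) => n /= nN; apply: sE => x /=.
rewrite in_itv /= => x01; apply: be; rewrite /= /ball /= distrC.
have [k Kl bk] := Nn n nN.
rewrite /tree_poly node_poly_mean; have := percolates_dist x01 bk.
rewrite /percolates => /le_lt_trans; apply.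
by have := Kk k Kl; lra.
Qed.

Lemma separation_cvg t m : binary_depth_cvg t ->
  separation_size_prob (t n) R m @[n --> \oo] -->
  central_bin R m * \int[mu]_(x in `[0%R, 1%R]) limit_density m x.
Proof.
move=> ht; apply/cvgrPdist_le => e e0.
have b0 : 0 <= central_bin R m by exact: ler0n.
pose d := e / (2 * (central_bin R m + 1)).
have d0 : 0 < d by rewrite divr_gt0 //; lra.
have [K Kk] := rate_small d0; have [N Nn] := ht (K + m.+1)%N.
apply: filterS (nbhs_infty_ge N) => n /= nN.
have [k Kl bk] := Nn n nN; rewrite distrC.
apply: le_trans (separation_dist _ bk) _; first lia.
have := Kk (k - m.+1)%N ltac:(lia); move: (rate _ _) => r rd.
have r2 : central_bin R m * (2 * r) <= central_bin R m * (2 * d) by apply: ler_wpM2l => //; lra.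
apply: (le_trans r2).
have de : e = (central_bin R m + 1) * (2 * d) by rewrite /d; field; rewrite gt_eqF //; lra.
rewrite de; apply: ler_wpM2r; lra.
Qed.

Lemma complete_tree_depth : binary_depth_cvg (fun n => complete_tree (ltn0Sn n)).
Proof.
move=> K; exists (2 ^ K.+1)%N => n nK.
exists (trunc_log 2 n.+1).-1; last first.
  apply: complete_tree_binary; rewrite prednK //.
  by apply: leq_trans (_ : K.+1 <= _)%N => //; apply: trunc_log_max => //; apply: leqW.
by rewrite -ltnS prednK; have : (K.+1 <= trunc_log 2 n.+1)%N by [apply: trunc_log_max => //; apply: leqW]; lia.
Qed.

Lemma full_tree_depth : binary_depth_cvg (fun n => full_tree (ltn0Sn n)).
Proof.
move=> K; exists K.+1 => -[//|n] nK; exists n => //; exact: full_tree_binary.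
Qed.

End Limits.

Local Open Scope classical_set_scope.

Theorem proposition30 (R : realType) :
  {uniform `[0%R, 1%R],
    (fun (n : nat) (x : R) =>
       (map_poly intr (tree_poly (complete_tree (ltn0Sn n)))).[x]) @ \oo
    --> (@phi R : R -> R)} /\
  (forall m : nat,
    let I : R := 'C(2 * m, m)%:R *
      \int[@lebesgue_measure R]_(x in `[0, 1])
        (x ^ (m%:Z - 1) * (1 - x) ^+ m * phi x) in
    (separation_size_prob (complete_tree (ltn0Sn n)) R m @[n --> \oo] --> I) /\
    (separation_size_prob (full_tree (ltn0Sn n)) R m @[n --> \oo] --> I)).
Proof.
split; first exact: tree_poly_cvg complete_tree_depth.
by move=> m I; split; apply: separation_cvg; [exact: complete_tree_depth|exact: full_tree_depth].
Qed.
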